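(* Let $R>0$, $A=RB^2$, and fix $K\in\mathcal K^2$ with $K\subseteq A$ and $\dim K\ge1$, and $i,j\in\{1,2\}$. Among all densities $f\colon\mathcal L_1^2\to[0,\infty)$ with respect to $\nu_1^2$ that are positive $\nu_1^2$-almost surely, the estimator $$\frac{\hat\varphi_{ij}(K\cap E)}{f(\pi(E))},\qquad E\ \text{an } f\text{-weighted random line in }\mathbb R^2\text{ hitting }A,$$ has minimal variance if and only if $f=f_K^*$ holds $\nu_1^2$-almost surely, where $$f_K^*(L)\propto\sqrt{2R\,V_1(K|L^\perp)}\;|g_{ij}(L)|$$ is a density with respect to $\nu_1^2$ that depends on $i,j$ and $K$.
   Context: $\mathcal K^2$ is the set of compact convex subsets of $\mathbb R^2$; $B^2$ is the closed unit disc centred at the origin; $\dim K$ is the dimension of the affine hull of $K$. $\mathcal L^2_1$ is the set of lines through the origin in $\mathbb R^2$ and $\nu_1^2$ its rotation invariant probability measure. $\mathcal E_1^2$ is the set of affine lines in $\mathbb R^2$ and $\mu_1^2$ the motion invariant measure on it normalized by $\mu_1^2(\{E:E\cap B^2\neq\emptyset\})=2$. $\pi(E)\in\mathcal L_1^2$ is the line through the origin parallel to $E$. $K|L^\perp$ is the orthogonal projection of $K$ onto $L^\perp$ and $V_1(K|L^\perp)$ its length. $V_0(M)=1$ if $M$ is a non-empty convex body and $V_0(\emptyset)=0$. For $u=(u_1,u_2)\in S^1$ with linear span $[u]$, the symmetric matrix $(g_{ij}([u]))$ is given by $$g_{11}([u])=\tfrac38\big(u_1^2-\tfrac13\big),\quad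 g_{12}([u])=g_{21}([u])=\tfrac38u_1u_2,\quad g_{22}([u])=\tfrac38\big(u_2^2-\tfrac13\big),$$ and $\hat\varphi_{ij}(K\cap E):=2R\,g_{ij}(\pi(E))\,V_0(K\cap E)$. For a density $f$ with respect to $\nu_1^2$, an $f$-weighted random line $E$ in $\mathbb R^2$ hitting $A$ is a random line with distribution $$P(E\in\mathcal A)=\frac1{2R}\int_{\mathcal A}\mathbf 1(E'\cap A\ne\emptyset)\,f(\pi(E'))\,\mu_1^2(dE'),\qquad\mathcal A\in\mathcal B(\mathcal E_1^2).$$ *)

(* Defs.v *)
From HB Require Import structures.
From mathcomp Require Import all_boot all_order all_algebra.
From mathcomp Require Import all_classical all_reals all_analysis.
Import Order.TTheory GRing.Theory Num.Theory.
Import numFieldNormedType.Exports.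

Set Implicit Arguments.
Unset Strict Implicit.
Unset Printing Implicit Defensive.

Local Open Scope classical_set_scope.
Local Open Scope ring_scope.

(* Points of R^2 are row vectors. The norm that the library puts on 'rV[R]_2
   is the sup norm: it is used only for its topology, and the Euclidean
   structure is the one given by dot and enorm. *)

Section plane.
Variable R : realType.
Local Notation plane := 'rV[R]_2.

Definition dot (x y : plane) : R := \sum_(k < 2) x ord0 k * y ord0 k.

Definition enorm (x : plane) : R := Num.sqrt (dot x x).

Definition unit_disc : set plane := [set x | enorm x <= 1].

Definition disc (r : R) : set plane := [set r *: x | x in unit_disc].

(* The empty set is a convex body, as in the class K^2. *)
Definition convex_body (K : set plane) : Prop :=
  compact K /\ convex_set (K : set (convex_lmodType plane)).

Definition affine_hull (K : set plane) : set plane :=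
  [set x | exists n (p : 'I_n -> plane) (c : 'I_n -> R),
    [/\ forall k, K (p k), \sum_k c k = 1 & x = \sum_k c k *: p k]].

(* The affine hull of K is a translate of a linear subspace of dimension d.
   No d satisfies this when K is empty. *)
Definition has_dim (K : set plane) (d : nat) : Prop :=
  exists (a : plane) (V : {vspace plane}),
    affine_hull K = [set a + v | v in [set v | v \in V]] /\ \dim V = d.

Definition line (a v : plane) : set plane := [set a + t *: v | t in [set: R]].

Record dline := DLine {
  dline_set :> set plane ;
  dlineP : exists2 v, v != 0 & dline_set = line 0 v }.

Record aline := ALine {
  aline_set :> set plane ;
  alineP : exists a, exists2 v, v != 0 & aline_set = line a v }.

Lemma dline_inj (L M : dline) : L = M :> set plane -> L = M.
Proof.
by case: L M => [L pL] [M pM] /= LM; subst M; congr DLine; exact: Prop_irrelevance.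
Qed.

Lemma aline_inj (E F : aline) : E = F :> set plane -> E = F.
Proof.
by case: E F => [E pE] [F pF] /= EF; subst F; congr ALine; exact: Prop_irrelevance.
Qed.

Definition span_line (v : plane) (v0 : v != 0) : dline :=
  DLine (ex_intro2 _ _ v v0 erefl).

Definition through (a v : plane) (v0 : v != 0) : aline :=
  ALine (ex_intro _ a (ex_intro2 _ _ v v0 erefl)).

Lemma delta_neq0 : (delta_mx ord0 ord0 : plane) != 0.
Proof.
by apply/eqP => /rowP/(_ ord0); rewrite !mxE /= => /eqP; rewrite oner_eq0.
Qed.

HB.instance Definition _ := gen_eqMixin dline.
HB.instance Definition _ := gen_choiceMixin dline.
HB.instance Definition _ := isPointed.Build dline (span_line delta_neq0).

HB.instance Definition _ := gen_eqMixin aline.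
HB.instance Definition _ := gen_choiceMixin aline.
HB.instance Definition _ := isPointed.Build aline (through 0 delta_neq0).

(* Lines carry the quotient topologies of the maps v |-> R v on R^2 \ {0} and
   (a, v) |-> a + R v on R^2 x (R^2 \ {0}). *)

Definition dline_open : set_system dline :=
  [set U | open [set v : plane | exists v0 : v != 0, U (span_line v0)]].

Definition aline_open : set_system aline :=
  [set U | open [set av : plane * plane |
                   exists v0 : av.2 != 0, U (through av.1 v0)]].

Lemma open_neq0 : open [set v : plane | v != 0].
Proof.
rewrite (_ : [set v : plane | v != 0] = ~` [set 0]); last first.
  by apply/seteqP; split => v /= /eqP.
exact/closed_openC/accessible_closed_set1/hausdorff_accessible/norm_hausdorff.
Qed.

Lemma dline_openT : dline_open setT.
Proof.
rewrite /dline_open /= (_ : mkset _ = [set v : plane | v != 0]).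
  exact: open_neq0.
by apply/seteqP; split => v /= => [[v0 _]|v0] //; exists v0.
Qed.

Lemma dline_openI : setI_closed dline_open.
Proof.
move=> U V /= oU oV; rewrite /dline_open /=.
apply: (eq_ind _ open (openI oU oV)); apply/seteqP; split => v /=.
  by move=> [[v0 Uv] [v1 Vv]]; exists v0; split => //; rewrite (Prop_irrelevance v0 v1).
by move=> [v0 [Uv Vv]]; split; exists v0.
Qed.

Lemma dline_open_bigU (I : Type) (f : I -> set dline) :
  (forall i, dline_open (f i)) -> dline_open (\bigcup_i f i).
Proof.
move=> of_; rewrite /dline_open /=.
apply: (eq_ind _ open (bigcup_open (D := setT) (fun i _ => of_ i))).
apply/seteqP; split => v /=.
  by move=> [i _ [v0 fv]]; exists v0; exists i.
by move=> [v0 [i _ fv]]; exists i => //; exists v0.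
Qed.

Lemma aline_openT : aline_open setT.
Proof.
rewrite /aline_open /=.
rewrite (_ : mkset _ = (@snd plane plane) @^-1` [set v : plane | v != 0]).
  by apply: open_comp; [move=> ? _; exact: cvg_snd|exact: open_neq0].
by apply/seteqP; split => av /= => [[v0 _]|v0] //; exists v0.
Qed.

Lemma aline_openI : setI_closed aline_open.
Proof.
move=> U V /= oU oV; rewrite /aline_open /=.
apply: (eq_ind _ open (openI oU oV)); apply/seteqP; split => av /=.
  by move=> [[v0 Uv] [v1 Vv]]; exists v0; split => //; rewrite (Prop_irrelevance v0 v1).
by move=> [v0 [Uv Vv]]; split; exists v0.
Qed.

Lemma aline_open_bigU (I : Type) (f : I -> set aline) :
  (forall i, aline_open (f i)) -> aline_open (\bigcup_i f i).
Proof.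
move=> of_; rewrite /aline_open /=.
apply: (eq_ind _ open (bigcup_open (D := setT) (fun i _ => of_ i))).
apply/seteqP; split => av /=.
  by move=> [i _ [v0 fv]]; exists v0; exists i.
by move=> [v0 [i _ fv]]; exists i => //; exists v0.
Qed.

HB.instance Definition _ :=
  isOpenTopological.Build dline dline_openT dline_openI dline_open_bigU.

HB.instance Definition _ :=
  isOpenTopological.Build aline aline_openT aline_openI aline_open_bigU.

(* Both spaces of lines are measurable spaces for their Borel sigma-algebra. *)

HB.instance Definition _ := @isMeasurable.Build (sigma_display (@open dline))
  dline <<s @open dline >> (@sigma_algebra0 _ setT (@open dline))
  (@sigma_algebraC _ (@open dline)) (@sigma_algebra_bigcup _ setT (@open dline)).

HB.instance Definition _ := @isMeasurable.Build (sigma_display (@open aline))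
  aline <<s @open aline >> (@sigma_algebra0 _ setT (@open aline))
  (@sigma_algebraC _ (@open aline)) (@sigma_algebra_bigcup _ setT (@open aline)).

Definition rotation (Q : 'M[R]_2) : Prop := Q *m Q^T = 1%:M /\ \det Q = 1.

Definition rotation_invariant (nu : set dline -> \bar R) : Prop :=
  forall Q, rotation Q -> forall D, measurable D ->
    nu [set L : dline | exists2 M : dline, D M &
          L = [set x *m Q | x in M] :> set plane] = nu D.

Definition motion_invariant (mu : set aline -> \bar R) : Prop :=
  forall Q t, rotation Q -> forall D, measurable D ->
    mu [set E : aline | exists2 F : aline, D F &
          E = [set x *m Q + t | x in F] :> set plane] = mu D.

Definition hits (M : set plane) : set aline :=
  [set E : aline | (E : set plane) `&` M !=set0].

Lemma direction_subproof (E : aline) : exists2 v, v != 0 &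
  [set x - y | x in (E : set plane) & y in (E : set plane)] = line 0 v.
Proof.
have [a [v v0 ->]] := alineP E; exists v => //; apply/seteqP; split => z /=.
  move=> [_ [s _ <-]] [_ [t _ <-]] <-; exists (s - t) => //.
  by rewrite add0r scalerBl opprD addrACA subrr add0r.
move=> [t _ <-]; exists (a + t *: v); first by exists t.
by exists a; [exists 0 => //; rewrite scale0r addr0|rewrite addrAC subrr].
Qed.

Definition direction (E : aline) : dline := DLine (direction_subproof E).

(* One of the two unit vectors that span L, by unit_vectorE, and the
   corresponding unit normal of L. *)
Definition unit_vector (L : dline) : plane :=
  xget 0 [set u | enorm u = 1 /\ (L : set plane) = line 0 u].

Definition unit_normal (L : dline) : plane :=
  \row_(k < 2) (if k == 0 then - unit_vector L ord0 1 else unit_vector L ord0 0).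

Lemma dotZ (c : R) (x : plane) : dot (c *: x) (c *: x) = c ^+ 2 * dot x x.
Proof.
by rewrite /dot mulr_sumr; apply: eq_bigr => k _; rewrite !mxE mulrACA -expr2.
Qed.

Lemma dot_gt0 (x : plane) : x != 0 -> 0 < dot x x.
Proof.
move=> x0; rewrite lt_neqAle sumr_ge0 ?andbT => [|k _]; last by rewrite -expr2 sqr_ge0.
apply: contraNN x0; rewrite eq_sym psumr_eq0 => [|k _]; last by rewrite -expr2 sqr_ge0.
move=> /allP h; apply/eqP/rowP => k; rewrite mxE.
by have /eqP := h k (mem_index_enum k); rewrite -expr2 => /eqP; rewrite sqrf_eq0 => /eqP.
Qed.

Lemma unit_vectorP (L : dline) :
  enorm (unit_vector L) = 1 /\ (L : set plane) = line 0 (unit_vector L).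
Proof.
suff [u uP] : exists u, enorm u = 1 /\ (L : set plane) = line 0 u.
  by rewrite /unit_vector; case: xgetP => [w _ //|/(_ u)].
have [v v0 ->] := dlineP L; have d0 := dot_gt0 v0.
have n0 : enorm v != 0 by rewrite sqrtr_eq0 -ltNge.
exists ((enorm v)^-1 *: v); split.
  rewrite {1}/enorm dotZ sqrtrM ?sqr_ge0// -/(enorm v) sqrtr_sqr ger0_norm.
    by rewrite mulVf.
  by rewrite invr_ge0 sqrtr_ge0.
apply/seteqP; split => x [t _ <-].
  by exists (t * enorm v) => //; rewrite scalerA -mulrA mulfV ?mulr1.
by exists (t / enorm v) => //; rewrite scalerA.
Qed.

Lemma unit_vectorE (L : dline) (u : plane) :
  enorm u = 1 -> (L : set plane) = line 0 u ->
  unit_vector L = u \/ unit_vector L = - u.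
Proof.
move=> u1 Lu; have [w1 Lw] := unit_vectorP L.
have : line 0 u (unit_vector L).
  by rewrite -Lu Lw; exists 1 => //; rewrite scale1r add0r.
move=> [t _]; rewrite add0r => tu; move: w1; rewrite -tu {1}/enorm dotZ.
rewrite sqrtrM ?sqr_ge0// -/(enorm u) u1 mulr1 sqrtr_sqr => /eqP.
by rewrite eqr_norml => /andP[/orP[]/eqP-> _]; rewrite ?scaleN1r ?scale1r; [left|right].
Qed.

Definition orthogonal_complement (M : set plane) : set plane :=
  [set y | forall x, M x -> dot x y = 0].

(* K | M for a linear subspace M *)
Definition projection (K M : set plane) : set plane :=
  [set y | M y /\ exists2 x, K x & orthogonal_complement M (x - y)].

(* V_1(K | L^\perp), the one-dimensional Lebesgue measure of the set of
   coordinates of K | L^\perp with respect to the unit vector of L^\perp *)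
Definition projection_length (K : set plane) (L : dline) : R :=
  fine (lebesgue_measure
    [set t : R | projection K (orthogonal_complement L) (t *: unit_normal L)]).

(* g_ii = 3/8 (u_i^2 - 1/3) and g_ij = 3/8 u_i u_j for i != j *)
Definition g_of_vector (u : plane) : 'M[R]_2 :=
  \matrix_(i < 2, j < 2)
    (3 / 8 * (u ord0 i * u ord0 j - (if i == j then 1 / 3 else 0))).

Definition g_matrix (L : dline) : 'M[R]_2 := g_of_vector (unit_vector L).

Lemma g_matrixE (L : dline) (u : plane) :
  enorm u = 1 -> (L : set plane) = line 0 u -> g_matrix L = g_of_vector u.
Proof.
move=> u1 Lu; rewrite /g_matrix; have [->//|->] := unit_vectorE u1 Lu.
by apply/matrixP => i j; rewrite !mxE mulrNN.
Qed.

Definition V0 (M : set plane) : R := if `[< M !=set0 >] then 1 else 0.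

Definition phi_hat (r : R) (i j : 'I_2) (K : set plane) (E : aline) : R :=
  2 * r * g_matrix (direction E) i j * V0 (K `&` E).

Definition is_density (nu : {measure set dline -> \bar R}) (f : dline -> R) :=
  [/\ measurable_fun setT f, forall L, 0 <= f L & (\int[nu]_L (f L)%:E = 1)%E].

Definition positive_density (nu : {measure set dline -> \bar R})
    (f : dline -> R) : Prop :=
  is_density nu f /\ \forall L \ae nu, 0 < f L.

(* X is an f-weighted random line hitting r B^2. *)
Definition weighted_random_line (mu : {measure set aline -> \bar R}) (r : R)
    (f : dline -> R) d (T : measurableType d) (P : probability T R)
    (X : {RV P >-> aline}) : Prop :=
  forall D, measurable D -> distribution P X D =
    (((2 * r)^-1)%:E *
      \int[mu]_(E in D) (\1_(hits (disc r)) E * f (direction E))%:E)%E.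

Definition estimator (r : R) (i j : 'I_2) (K : set plane) (f : dline -> R)
    (E : aline) : R :=
  phi_hat r i j K E / f (direction E).

(* The variances take values in [0, +oo]. *)
Definition has_minimal_variance (nu : {measure set dline -> \bar R})
    (mu : {measure set aline -> \bar R}) (r : R) (i j : 'I_2) (K : set plane)
    (f : dline -> R) : Prop :=
  forall d (T : measurableType d) (P : probability T R) (X : {RV P >-> aline}),
    weighted_random_line mu r f X ->
  forall h, positive_density nu h ->
  forall d' (T' : measurableType d') (P' : probability T' R)
    (Y : {RV P' >-> aline}),
    weighted_random_line mu r h Y ->
  (variance P (estimator r i j K f \o X) <=
     variance P' (estimator r i j K h \o Y))%E.

Definition optimal_weight (r : R) (i j : 'I_2) (K : set plane) (L : dline) : R :=
  Num.sqrt (2 * r * projection_length K L) * `|g_matrix L i j|.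

Definition optimal_density (nu : {measure set dline -> \bar R}) (r : R)
    (i j : 'I_2) (K : set plane) (L : dline) : R :=
  optimal_weight r i j K L / fine (\int[nu]_M (optimal_weight r i j K M)%:E)%E.

End plane.

(* Main.v *)
Require Import Defs.
From HB Require Import structures.
From mathcomp Require Import all_boot all_order all_algebra.
From mathcomp Require Import all_classical all_reals all_analysis.
From mathcomp Require Import measurable_realfun.
From mathcomp Require Import ring lra.
Import Order.TTheory GRing.Theory Num.Theory.
Import numFieldNormedType.Exports.

Set Implicit Arguments.
Unset Strict Implicit.
Unset Printing Implicit Defensive.

Local Open Scope classical_set_scope.
Local Open Scope ring_scope.

(** Let w be the weight sqrt(2R V_1(K | L^perp)) |g_ij(L)| and W its nu-integral.
    The motion invariant measure mu and the rotation invariant nu are related by the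
    Cauchy-Crofton formula
      int 1(E hits K) H(pi(E)) mu(dE) = int H(L) V_1(K | L^perp) nu(dL).
    By this formula the mean m of the estimator does not depend on f, and its second
    moment is int w^2/f dnu. Expanding (w - W f)^2 / f and using int f dnu = 1 gives
      Var + m^2 = W^2 + int (w - W f)^2 / f dnu,
    whose last term is nonnegative and vanishes exactly when f = w / W almost surely.

    The Cauchy-Crofton formula follows from two applications of Tonelli's theorem.
    Averaging mu over the translations s e_1 of the line gives
      int 1(E hits K) H width_C dmu = int 1(E hits C) H width_K dmu
    for any two convex bodies, because {s : E + s e_1 hits C} is an interval whose
    length is width_C up to a factor that depends on the direction alone. For C the unit
    disc, the directions of the lines hitting C have a rotation invariant law of mass 2;
    it is 2 nu, since two finite invariant measures on the circle group of directions
    are proportional, as one sees by integrating over products. *)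

(** * Plane geometry *)

Section plane_geometry.
Context {R : realType}.
Local Notation plane := 'rV[R]_2.
Implicit Types (u v w x y : plane) (K : set plane) (L : dline R) (E : aline R).

(** Lines form a quotient space, and Tonelli's theorem needs integrands that are jointly measurable
    in a line and a real number. Hence the single chart [slope], [offset]: off the horizontal
    direction a line has an equation x_1 + k x_2 = c, translation by s e_1 adds s to c, and hitting
    a convex body is an interval condition on c whose ends are support values at the normals (1, k)
    and -(1, k). The price is the horizontal direction, which must be null: a finite rotation
    invariant measure has no atoms, since infinitely many rotations move an atom to distinct lines.
    Tonelli's theorem also needs mu to be sigma-finite; this follows from invariance and the value 2
    on the lines hitting the unit disc, because every line hits one of countably many integer
    translates of that disc along the axes. Variances may be infinite, so every expansion of a
    square is arranged as an equality between sums of integrals of nonnegative functions. Finally,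
    minimality quantifies over random lines with a given law; deducing anything from it requires
    that such lines exist. *)

Definition perp v : plane :=
  \row_(k < 2) (if k == 0 then - v ord0 1 else v ord0 0).

Lemma dotE x y : dot x y = x ord0 0 * y ord0 0 + x ord0 1 * y ord0 1.
Proof.
rewrite /dot big_ord_recl big_ord1; congr (_ * _ + _ * _); congr (_ _ _);
  exact: val_inj.
Qed.

Lemma ord2P (k : 'I_2) : k = 0 \/ k = 1.
Proof. by case: k => [[|[|//]] h]; [left|right]; exact: val_inj. Qed.

Lemma plane_eqP x y : x ord0 0 = y ord0 0 -> x ord0 1 = y ord0 1 -> x = y.
Proof. by move=> e0 e1; apply/rowP => k; case: (ord2P k) => ->. Qed.

Lemma perp0 v : perp v ord0 0 = - v ord0 1. Proof. by rewrite mxE. Qed.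
Lemma perp1 v : perp v ord0 1 = v ord0 0. Proof. by rewrite mxE. Qed.

Lemma dot_perp v w : dot v (perp w) = v ord0 1 * w ord0 0 - v ord0 0 * w ord0 1.
Proof. by rewrite dotE perp0 perp1; ring. Qed.

Lemma dotDl x y w : dot (x + y) w = dot x w + dot y w.
Proof. by rewrite !dotE !mxE; ring. Qed.

Lemma dotZl c x w : dot (c *: x) w = c * dot x w.
Proof. by rewrite !dotE !mxE; ring. Qed.

Lemma dotNl x w : dot (- x) w = - dot x w.
Proof. by rewrite !dotE !mxE; ring. Qed.

Lemma dotNr x w : dot x (- w) = - dot x w.
Proof. by rewrite !dotE !mxE; ring. Qed.

Lemma dotZr c x w : dot x (c *: w) = c * dot x w.
Proof. by rewrite !dotE !mxE; ring. Qed.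

Lemma dotC x w : dot x w = dot w x.
Proof. by rewrite !dotE; ring. Qed.

Lemma perpZ c v : perp (c *: v) = c *: perp v.
Proof. by apply: plane_eqP; rewrite !mxE/= ?mxE; ring. Qed.

Lemma enorm_sqr v : enorm v ^+ 2 = v ord0 0 ^+ 2 + v ord0 1 ^+ 2.
Proof. by rewrite sqr_sqrtr ?dotE -?expr2// addr_ge0 ?sqr_ge0. Qed.

(** A line is a level set of the linear form [dot _ (perp v)]; all later incidence questions become
    equations or inequalities for this form. *)
Lemma lineP v x y : v != 0 -> line x v y <-> dot y (perp v) = dot x (perp v).
Proof.
move=> v0; rewrite !dot_perp; split => [[t _ <-]|h]; first by rewrite !mxE; ring.
have := dot_gt0 v0; rewrite dotE => /lt0r_neq0 d0.
(* [e] is the determinant of [v] and [y - x]. The witness is the coefficient of the projection of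
   [y - x] onto [v]; after clearing its denominator, the error in each coordinate is a multiple of
   [e]. *)
pose e := (y ord0 1 - x ord0 1) * v ord0 0 - (y ord0 0 - x ord0 0) * v ord0 1.
have e0 : e = 0 by rewrite /e; lra.
exists (((y ord0 0 - x ord0 0) * v ord0 0 + (y ord0 1 - x ord0 1) * v ord0 1) /
    (v ord0 0 * v ord0 0 + v ord0 1 * v ord0 1)) => //.
apply: plane_eqP; rewrite !mxE; apply: (mulIf d0); rewrite mulrDl mulrAC divfK//;
  apply: subr0_eq.
  by transitivity (e * v ord0 1); [rewrite /e; ring|rewrite e0 mul0r].
by transitivity (- (e * v ord0 0)); [rewrite /e; ring|rewrite e0 mul0r oppr0].
Qed.

Lemma span_lineP v (v0 : v != 0) x : dline_set (span_line v0) x <-> dot x (perp v) = 0.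
Proof.
apply: (iff_trans (lineP 0 x v0)).
by rewrite [dot 0 _]big1// => k _; rewrite mxE mul0r.
Qed.

Lemma throughP x v (v0 : v != 0) y :
  aline_set (through x v0) y <-> dot y (perp v) = dot x (perp v).
Proof. exact: lineP. Qed.

Lemma dline_spanP L : exists v, exists v0 : v != 0, L = span_line v0.
Proof. by have [v v0 Lv] := dlineP L; exists v, v0; exact: dline_inj. Qed.

Lemma aline_throughP E :
  exists x, exists v, exists v0 : v != 0, E = through x v0.
Proof. by have [a [v v0 Ea]] := alineP E; exists a, v, v0; exact: aline_inj. Qed.

Lemma span_line_eqP v w (v0 : v != 0) (w0 : w != 0) :
  span_line v0 = span_line w0 <-> dot v (perp w) = 0.
Proof.
split=> [vw|vw].
  by apply/(span_lineP w0); rewrite -vw; apply/span_lineP; rewrite dot_perp; ring.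
apply/dline_inj/seteqP; split => z [t _ <-].
  by apply/span_lineP; rewrite add0r dotZl vw mulr0.
apply/span_lineP; rewrite add0r dotZl (_ : dot w _ = - dot v (perp w)).
  by rewrite vw oppr0 mulr0.
by rewrite !dot_perp; ring.
Qed.

Lemma direction_through x v (v0 : v != 0) : direction (through x v0) = span_line v0.
Proof.
apply/dline_inj/seteqP; split => z /=.
  move=> [_ [s _ <-]] [_ [t _ <-]] <-; exists (s - t) => //.
  by rewrite add0r scalerBl opprD addrACA subrr add0r.
move=> [t _ <-]; exists (x + t *: v); first by exists t.
by exists x; [exists 0 => //; rewrite scale0r addr0|rewrite addrAC subrr].
Qed.

(** [unit_vector] is a choice between two opposite vectors, so later computations use only its
    proportionality to a given spanning vector. *)
Lemma unit_vector_span v (v0 : v != 0) :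
  exists2 c, c != 0 & unit_vector (span_line v0) = c *: v.
Proof.
have [u1 Lu] := unit_vectorP (span_line v0).
have : dline_set (span_line v0) (unit_vector (span_line v0)).
  by rewrite Lu; exists 1 => //; rewrite scale1r add0r.
move=> [t _]; rewrite add0r => tv; exists t => //.
apply: contra_eqT u1 => /negPn/eqP t0; rewrite -tv t0 /enorm dotZ expr0n/= mul0r sqrtr0.
by rewrite eq_sym oner_eq0.
Qed.

Lemma enorm_unit_vector L :
  unit_vector L ord0 0 ^+ 2 + unit_vector L ord0 1 ^+ 2 = 1.
Proof. by have [u1 _] := unit_vectorP L; rewrite -enorm_sqr u1 expr1n. Qed.

Lemma unit_normalE L : unit_normal L = perp (unit_vector L).
Proof. by []. Qed.

End plane_geometry.

(** * Support functions and widths *)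

Section support_function.
Context {R : realType}.
Local Notation plane := 'rV[R]_2.
Implicit Types (u v w x y : plane) (K : set plane) (L : dline R).

Definition support K w : R := sup [set dot x w | x in K].

(** Summing over both unit normals removes the dependence on the sign chosen by [unit_vector]. On
    nonempty convex bodies this is V_1(K | L^perp), by [projection_lengthE]. *)
Definition width K L : R :=
  support K (unit_normal L) + support K (- unit_normal L).

Lemma continuous_dotl w : continuous (fun x : plane => dot x w).
Proof.
move=> x; rewrite (_ : (fun x => _) = fun x : plane => x ord0 0 * w ord0 0 + x ord0 1 * w ord0 1).
  have F : Filter (nbhs x) by exact: nbhs_filter.
  by apply: (cvgD (FF := F)); apply: (cvgMr_tmp (FF := F)); exact: coord_continuous.
by apply/funext => y; rewrite dotE.
Qed.

Lemma support_max K w : compact K -> K !=set0 ->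
  exists2 x, K x & support K w = dot x w.
Proof.
move=> cK K0; have [|x xK xmax] := @EVT_max_rV R 2 (fun x => dot x w) K K0 cK.
  by apply: continuous_subspaceT; exact: continuous_dotl.
have Kx := set_mem xK; exists x => //; apply/eqP; rewrite eq_le; apply/andP; split.
  rewrite /support; apply: ge_sup; first by exists (dot x w), x.
  by move=> _ [y Ky <-]; apply: xmax; exact/mem_set.
apply: sup_upper_bound; last by exists x.
split; first by exists (dot x w), x.
by exists (dot x w) => _ [y Ky <-]; apply: xmax; exact/mem_set.
Qed.

Lemma support_ub K w x : compact K -> K x -> dot x w <= support K w.
Proof.
move=> cK Kx; apply: sup_upper_bound; last by exists x.
have K0 : K !=set0 by exists x.
have [|z zK zmax] := @EVT_max_rV R 2 (fun x => dot x w) K K0 cK.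
  by apply: continuous_subspaceT; exact: continuous_dotl.
split; first by exists (dot x w), x.
by exists (dot z w) => _ [y Ky <-]; apply: zmax; exact/mem_set.
Qed.

Lemma support_lb K w x : compact K -> K x -> - support K (- w) <= dot x w.
Proof. by move=> cK Kx; rewrite lerNl -dotNr support_ub. Qed.

Lemma convex_setP K x y (t : R) : convex_set (K : set (convex_lmodType plane)) ->
  K x -> K y -> 0 <= t <= 1 -> K (t *: x + (1 - t) *: y).
Proof.
move=> cK Kx Ky /andP[t0 t1].
have t01 : Itv.spec (@Itv.num_sem R) (Itv.Real `[0%Z, 1%Z]) t.
  by rewrite /Itv.spec/= /Itv.num_sem/= in_itv/= t0 t1 ger0_real.
by have := cK x y (Itv.mk t01) (mem_set Kx) (mem_set Ky); rewrite inE.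
Qed.

(** Compactness provides points of [K] where the form attains its two extreme values; the segment
    joining them stays in [K] and takes every value in between. *)
Lemma support_itv K w : convex_body K -> K !=set0 ->
  [set dot x w | x in K] = `[- support K (- w), support K w]%classic.
Proof.
move=> [cK convK] K0; apply/seteqP; split => [_ [x Kx <-]|c] /=.
  by rewrite in_itv/= support_lb// support_ub.
rewrite in_itv/= => /andP[].
have [x Kx ->] := support_max w cK K0.
have [y Ky ->] := support_max (- w) cK K0.
rewrite dotNr opprK le_eqVlt => /predU1P[<- _|yc cx]; first by exists y.
have yx : 0 < dot x w - dot y w by rewrite subr_gt0 (lt_le_trans yc).
pose t := (c - dot y w) / (dot x w - dot y w).
have t01 : 0 <= t <= 1.
  rewrite /t ler_pdivrMr// mul1r lerD2r cx andbT.
  by apply: divr_ge0; [rewrite subr_ge0 ltW|exact: ltW].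
exists (t *: x + (1 - t) *: y); first exact: convex_setP.
rewrite dotDl !dotZl /t; field; exact: lt0r_neq0.
Qed.

Lemma ler_coord_mx_norm x (k : 'I_2) : `|x ord0 k| <= `|x|.
Proof.
have /mapP[j Hj ->] : `|x ord0 k| \in [seq `|x i.1 i.2| | i : 'I_1 * 'I_2].
  by apply/mapP; exists (ord0, k) => //=; rewrite mem_enum.
by rewrite [leRHS]/Num.norm /= mx_normrE; apply/bigmax_geP; right => /=; exists j.
Qed.

Lemma supportZ K c w : compact K -> K !=set0 -> 0 <= c ->
  support K (c *: w) = c * support K w.
Proof.
move=> cK K0 c0; apply/eqP; rewrite eq_le; apply/andP; split.
  have [x Kx ->] := support_max (c *: w) cK K0.
  by rewrite dotZr ler_wpM2l// support_ub.
have [x Kx ->] := support_max w cK K0.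
by rewrite -dotZr support_ub.
Qed.

(** Evaluating at a maximiser for [v] bounds the difference of the support values at [v] and [w]:
    the support function is Lipschitz, with a bound [N] on the coordinates of [K] as constant. *)
Lemma continuous_support K : compact K -> K !=set0 -> continuous (support K).
Proof.
move=> cK K0; have [M [_ KM]] := compact_bounded cK.
pose N := `|M| + 1; have N0 : 0 < N by rewrite ltr_pwDr.
have KN x (k : 'I_2) : K x -> `|x ord0 k| <= N.
  move=> Kx; apply: le_trans (ler_coord_mx_norm x k) (KM N _ x Kx).
  by rewrite (le_lt_trans (ler_norm M))// ltrDl.
have lip v w : support K v - support K w <=
    N * (`|v ord0 0 - w ord0 0| + `|v ord0 1 - w ord0 1|).
  have [x Kx ->] := support_max v cK K0; rewrite lerBlDr.
  have := support_ub w cK Kx.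
  rewrite -(lerD2l (N * (`|v ord0 0 - w ord0 0| + `|v ord0 1 - w ord0 1|))).
  apply: le_trans; rewrite -lerBlDr.
  rewrite (_ : dot x v - dot x w = x ord0 0 * (v ord0 0 - w ord0 0) +
    x ord0 1 * (v ord0 1 - w ord0 1)); last first.
    by rewrite !dotE; ring.
  by rewrite [leRHS]mulrDr lerD// (le_trans (ler_norm _))// normrM ler_wpM2r// KN.
move=> w; have F : Filter (nbhs w) by exact: nbhs_filter.
apply/(cvgrPdist_le (FF := F)) => e e0; near=> v.
have h : N * (`|w ord0 0 - v ord0 0| + `|w ord0 1 - v ord0 1|) <= e.
  rewrite -ler_pdivlMl// mulrC (splitr (e / N)) lerD//.
    near: v; have /cvgrPdist_le := @coord_continuous R 1 2 ord0 0 w.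
    by apply; rewrite !divr_gt0.
  near: v; have /cvgrPdist_le := @coord_continuous R 1 2 ord0 1 w.
  by apply; rewrite !divr_gt0.
rewrite (le_trans _ h)// ler_norml lip andbT lerNl opprB.
by rewrite (distrC (w _ _)) (distrC (w _ 1)) lip.
Unshelve. all: by end_near. Qed.

End support_function.

(** * Discs, projection lengths and incidence of lines with convex bodies *)

Section discs_and_widths.
Context {R : realType}.
Local Notation plane := 'rV[R]_2.
Implicit Types (u v w x y : plane) (K : set plane) (L : dline R) (r : R).

Lemma enorm_ge0 x : 0 <= enorm x.
Proof. exact: sqrtr_ge0. Qed.

(** Cauchy-Schwarz by Lagrange's identity: the difference of the squares is the square of a
    determinant. *)
Lemma dot_le_enorm x w : dot x w <= enorm x * enorm w.
Proof.
rewrite -(ger0_norm (mulr_ge0 (enorm_ge0 x) (enorm_ge0 w))).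
apply: le_trans (ler_norm _) _.
rewrite -(@ler_pXn2r _ 2)// ?nnegrE// real_normK ?num_real// real_normK ?num_real//.
rewrite exprMn !enorm_sqr dotE -subr_ge0.
rewrite (_ : _ - _ = (x ord0 0 * w ord0 1 - x ord0 1 * w ord0 0) ^+ 2); last by ring.
exact: sqr_ge0.
Qed.

Lemma enormZ c x : enorm (c *: x) = `|c| * enorm x.
Proof. by rewrite {1}/enorm dotZ sqrtrM ?sqr_ge0// sqrtr_sqr. Qed.

Lemma enorm0 : enorm (0 : plane) = 0.
Proof. by rewrite -(scale0r 0) enormZ normr0 mul0r. Qed.

Lemma enorm_eq0 x : (enorm x == 0) = (x == 0).
Proof.
apply/idP/idP => [|/eqP->]; last by rewrite enorm0.
by apply: contraLR => /dot_gt0 x0; rewrite sqrtr_eq0 -ltNge.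
Qed.

Lemma enormN x : enorm (- x) = enorm x.
Proof. by rewrite -scaleN1r enormZ normrN1 mul1r. Qed.

Lemma enorm_perp v : enorm (perp v) = enorm v.
Proof. by rewrite /enorm !dotE perp0 perp1 mulrNN addrC. Qed.

Lemma enorm_unit_normal L : enorm (unit_normal L) = 1.
Proof. by rewrite unit_normalE enorm_perp; have [] := unit_vectorP L. Qed.

Lemma discP r x : 0 < r -> disc r x <-> enorm x <= r.
Proof.
move=> r0; split => [[y y1 <-]|xr].
  by rewrite enormZ gtr0_norm// -[leRHS]mulr1 ler_wpM2l// ltW.
exists (r^-1 *: x); last by rewrite scalerA divff ?gt_eqF// scale1r.
by rewrite /unit_disc/= enormZ gtr0_norm ?invr_gt0// ler_pdivrMl// mulr1.
Qed.

Lemma disc1 : disc 1 = @unit_disc R.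
Proof.
by apply/seteqP; split => x; rewrite discP.
Qed.

Lemma disc_nonempty r : 0 < r -> (disc r : set plane) !=set0.
Proof. by move=> r0; exists 0; apply/discP => //; rewrite enorm0 ltW. Qed.

Lemma enormD x y : enorm (x + y) <= enorm x + enorm y.
Proof.
rewrite -(@ler_pXn2r _ 2)// ?nnegrE ?addr_ge0 ?enorm_ge0// sqrrD !enorm_sqr.
have := dot_le_enorm x y; rewrite dotE !mxE; lra.
Qed.

Lemma convex_body_disc r : 0 < r -> convex_body (disc r : set plane).
Proof.
move=> r0; split.
  have dE : disc r = (fun x : plane => dot x x) @^-1` [set t | t <= r ^+ 2].
    apply/seteqP; split => x /=; rewrite dotE -!expr2 -enorm_sqr.
      by move=> /(discP _ r0); rewrite ler_pXn2r// nnegrE ?enorm_ge0 ?(ltW r0).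
    move=> h; apply/discP => //.
    by move: h; rewrite ler_pXn2r// nnegrE ?enorm_ge0 ?(ltW r0).
  apply: bounded_closed_compact.
    exists r; split; first exact: num_real.
    move=> M rM x /(discP _ r0) xr; rewrite /Num.norm/= mx_normrE.
    apply: bigmax_le => [|[i k] _ /=]; first by rewrite (le_trans (ltW r0))// ltW.
    rewrite (ord1 i) (le_trans _ (ltW rM))// (le_trans _ xr)//.
    rewrite -(@ler_pXn2r _ 2)// ?nnegrE ?enorm_ge0// real_normK ?num_real//.
    by rewrite enorm_sqr; case: (ord2P k) => ->; rewrite ?lerDl ?lerDr sqr_ge0.
  rewrite dE; apply: closed_comp; last exact: closed_le.
  move=> x _ /=; have F : Filter (nbhs x) by exact: nbhs_filter.
  rewrite (_ : (fun x => _) = fun x : plane =>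
    x ord0 0 * x ord0 0 + x ord0 1 * x ord0 1); last first.
    by apply/funext => y; rewrite dotE.
  by apply: (cvgD (FF := F)); apply: (cvgM (FF := F)); exact: coord_continuous.
move=> x y t; rewrite !inE => /(discP _ r0) xr /(discP _ r0) yr.
suff : disc r (t%:num *: x + (1 - t%:num) *: y) by [].
apply/discP => //.
have t0 : 0 <= t%:num by rewrite ge0.
have t1 : 0 <= 1 - t%:num by rewrite subr_ge0 le1.
apply: le_trans (enormD _ _) _; rewrite !enormZ !ger0_norm//.
apply: (@le_trans _ _ (t%:num * r + (1 - t%:num) * r)).
  by rewrite lerD// ler_wpM2l.
by rewrite -mulrDl addrC subrK mul1r.
Qed.

Lemma support_disc r w : 0 < r -> support (disc r) w = r * enorm w.
Proof.
move=> r0; have [cK _] := convex_body_disc r0.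
apply/eqP; rewrite eq_le; apply/andP; split.
  have [x /(discP _ r0) xr ->] := support_max w cK (disc_nonempty r0).
  by rewrite (le_trans (dot_le_enorm x w))// ler_wpM2r// enorm_ge0.
have [->|w0] := eqVneq w 0.
  rewrite enorm0 mulr0; have [x _ ->] := support_max 0 cK (disc_nonempty r0).
  by rewrite dotE !mxE !mulr0 addr0.
have n0 : enorm w != 0 by rewrite enorm_eq0.
have -> : r * enorm w = dot ((r / enorm w) *: w) w.
  by rewrite dotZl dotE -!expr2 -enorm_sqr expr2 mulrA divfK.
apply: (support_ub w cK); apply/(discP _ r0).
rewrite enormZ ger0_norm; last by apply: divr_ge0; [exact: ltW|exact: enorm_ge0].
by rewrite divfK.
Qed.

Lemma width_disc r L : 0 < r -> width (disc r) L = 2 * r.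
Proof.
by move=> r0; rewrite /width !support_disc// enormN enorm_unit_normal; ring.
Qed.

Lemma hits_throughP K x v (v0 : v != 0) : convex_body K -> K !=set0 ->
  hits K (through x v0) <->
  - support K (- perp v) <= dot x (perp v) <= support K (perp v).
Proof.
move=> cK K0; rewrite -[X in _ <-> X](_ :
    `[- support K (- perp v), support K (perp v)]%classic (dot x (perp v)) = _); last first.
  by rewrite /= in_itv.
rewrite -support_itv//; split => [[y [/throughP xy Ky]]|[y Ky xy]].
  by exists y.
by exists y; split=> //; apply/throughP.
Qed.

Lemma width_ge0 K L : convex_body K -> K !=set0 -> 0 <= width K L.
Proof.
move=> [cK _] [x Kx]; rewrite /width -lerBlDr sub0r.
exact: le_trans (support_lb _ cK Kx) (support_ub _ cK Kx).
Qed.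

Lemma projection_lengthE K L : convex_body K -> K !=set0 ->
  projection_length K L = width K L.
Proof.
move=> cK K0; rewrite /projection_length.
set n := unit_normal L.
have nn : dot n n = 1.
  by rewrite dotE -!expr2 -enorm_sqr enorm_unit_normal expr1n.
have un : dot (unit_vector L) n = 0 by rewrite /n unit_normalE dot_perp; ring.
rewrite (_ : [set t | _] = [set dot x n | x in K]); last first.
  apply/seteqP; split => [t [_ [x Kx xt]]|_ [x Kx <-]] /=.
    exists x => //; have : orthogonal_complement L n.
      by have [_ ->] := unit_vectorP L => _ [s _ <-]; rewrite add0r dotZl un mulr0.
    move=> /xt; rewrite dotC dotDl dotNl dotZl nn mulr1 => /eqP.
    by rewrite subr_eq0 => /eqP.
  split.
    have [_ ->] := unit_vectorP L => _ [s _ <-].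
    by rewrite add0r dotZl dotZr un !mulr0.
  exists x => // y Ly.
  have : dot (unit_vector L) y = 0.
    apply: Ly; have [_ ->] := unit_vectorP L; exists 1 => //.
    by rewrite scale1r add0r.
  move: nn; rewrite /n unit_normalE !dotE !mxE/= => nn uy.
  set a := unit_vector L ord0 0 in nn uy *; set b := unit_vector L ord0 1 in nn uy *.
  (* A vector orthogonal to [L] is a multiple of the unit normal (-b, a); [c] is its coefficient. *)
  pose c := y ord0 0 * - b + y ord0 1 * a.
  have y0 : y ord0 0 = - b * c.
    transitivity (y ord0 0 * (- b * - b + a * a) - a * (a * y ord0 0 + b * y ord0 1)).
      by rewrite nn uy; ring.
    by rewrite /c; ring.
  have y1 : y ord0 1 = a * c.
    transitivity (y ord0 1 * (- b * - b + a * a) - b * (a * y ord0 0 + b * y ord0 1)).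
      by rewrite nn uy; ring.
    by rewrite /c; ring.
  clearbody c; rewrite y0 y1.
  transitivity (c * (x ord0 0 * - b + x ord0 1 * a) * (1 - (- b * - b + a * a))).
    by ring.
  by rewrite nn subrr mulr0.
rewrite support_itv// lebesgue_measure_itv/= lte_fin.
(* If the endpoints are not strictly ordered, the measure of the interval is 0; then the width is at
   most 0, hence 0. *)
case: ltP => [_|]; first by rewrite -EFinD /= opprK.
have := width_ge0 L cK K0; rewrite /width -/n => h1 h2.
by apply/esym/eqP; rewrite eq_le h1 andbT/= -lerBrDr sub0r.
Qed.

End discs_and_widths.

(** * Borel measurability on the spaces of lines *)

Section continuity.
Context {R : realType} {T : topologicalType}.
Implicit Types f g : T -> R.

Lemma continuous_addf f g : continuous f -> continuous g ->
  continuous (fun x => f x + g x).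
Proof. by move=> cf cg x; apply: cvgD; [exact: cf|exact: cg]. Qed.

Lemma continuous_mulf f g : continuous f -> continuous g ->
  continuous (fun x => f x * g x).
Proof. by move=> cf cg x; apply: cvgM; [exact: cf|exact: cg]. Qed.

Lemma continuous_oppf f : continuous f -> continuous (fun x => - f x).
Proof. by move=> cf x; apply: cvgN; exact: cf. Qed.

Lemma continuous_plane (F : T -> 'rV[R]_2) :
  continuous (fun x => F x ord0 0) -> continuous (fun x => F x ord0 1) ->
  continuous F.
Proof.
move=> c0 c1 x.
rewrite (_ : F = fun x => F x ord0 0 *: delta_mx ord0 0 + F x ord0 1 *: delta_mx ord0 1).
  by apply: cvgD; apply: cvgZr_tmp; [exact: c0|exact: c1].
by apply/funext => y; apply: plane_eqP; rewrite !mxE/= ?mulr1 ?mulr0 ?addr0 ?add0r.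
Qed.

Lemma open_ltf f g : continuous f -> continuous g -> open [set x | f x < g x].
Proof.
move=> cf cg; rewrite (_ : mkset _ = (fun x => f x + - g x) @^-1` [set y | y < 0]).
  apply: open_comp; last exact: open_lt.
  by move=> x _; exact: continuous_addf cf (continuous_oppf cg) x.
by apply/seteqP; split => x /=; rewrite subr_lt0.
Qed.

End continuity.

Section line_measurability.
Context {R : realType}.
Local Notation plane := 'rV[R]_2.
Implicit Types (v w x y : plane) (K : set plane) (L : dline R) (E : aline R).

Lemma continuous_coord (T : topologicalType) (F : T -> plane) (k : 'I_2) :
  continuous F -> continuous (fun t => F t ord0 k).
Proof. by move=> cF t; exact: (continuous_comp (cF t) (@coord_continuous R 1 2 ord0 k (F t))). Qed.

Lemma dline_measurable (U : set (dline R)) :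
  open [set v : plane | exists v0 : v != 0, U (span_line v0)] -> measurable U.
Proof. by move=> oU; apply: sub_sigma_algebra. Qed.

Lemma aline_measurable (U : set (aline R)) :
  open [set xv : plane * plane | exists v0 : xv.2 != 0, U (through xv.1 v0)] ->
  measurable U.
Proof. by move=> oU; apply: sub_sigma_algebra. Qed.

Lemma measurable_fun_dline d (T : measurableType d) (f : T -> dline R) :
  (forall U, open U -> measurable (f @^-1` U)) -> measurable_fun setT f.
Proof.
move=> h; apply: (measurability (@open (dline R))); first by [].
by move=> _ [U oU <-]; rewrite setTI; exact: h.
Qed.

Lemma measurable_fun_aline d (T : measurableType d) (f : T -> aline R) :
  (forall U, open U -> measurable (f @^-1` U)) -> measurable_fun setT f.
Proof.
move=> h; apply: (measurability (@open (aline R))); first by [].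
by move=> _ [U oU <-]; rewrite setTI; exact: h.
Qed.

Lemma open_span_preimage (U : set (dline R)) : open U ->
  open [set v : plane | exists v0 : v != 0, U (span_line v0)].
Proof. by []. Qed.

Lemma open_through_preimage (U : set (aline R)) : open U ->
  open [set xv : plane * plane | exists v0 : xv.2 != 0, U (through xv.1 v0)].
Proof. by []. Qed.

Lemma measurable_direction : measurable_fun setT (@direction R).
Proof.
apply: measurable_fun_dline => U oU; apply: aline_measurable.
rewrite (_ : mkset _ = (@snd plane plane) @^-1`
    [set v : plane | exists v0 : v != 0, U (span_line v0)]).
  by apply: open_comp; [move=> ? _; exact: cvg_snd|exact: open_span_preimage].
by apply/seteqP; split => -[x v] /= [v0]; rewrite ?direction_through => Uv;
  exists v0; rewrite ?direction_through.
Qed.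

(** The complement is open: a vector spans a line other than that of [w] exactly when its
    determinant with [w] is nonzero. *)
Lemma measurable_dline_set1 L : measurable [set L].
Proof.
have [w [w0 ->]] := dline_spanP L.
rewrite -[X in measurable X]setCK; apply: measurableC; apply: dline_measurable.
rewrite (_ : mkset _ = [set v : plane | v != 0] `&`
    ([set v | dot v (perp w) < 0] `|` [set v | 0 < dot v (perp w)])).
  apply: openI; first exact: open_neq0.
  have c0 : continuous (fun _ : plane => 0 : R) by exact: cst_continuous.
  have cd : continuous (fun v : plane => dot v (perp w)) by exact: continuous_dotl.
  by apply: openU; [exact: (open_ltf cd c0)|exact: (open_ltf c0 cd)].
apply/seteqP; split => v /=.
  move=> [v0 vw]; split=> //; apply/orP; rewrite -neq_lt.
  by apply/eqP => e; apply: vw; apply/span_line_eqP.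
by move=> [v0 vw]; exists v0 => /span_line_eqP e; case: vw; rewrite e ltxx.
Qed.

Definition horizontal : dline R := span_line (delta_neq0 R).

(** The sign makes (-k, 1) a spanning vector and (1, k) a normal of a non-horizontal line of slope
    k. The quotient does not depend on the chosen unit vector. *)
Definition slope L : R := - (unit_vector L ord0 0 / unit_vector L ord0 1).

Lemma span_horizontal v (v0 : v != 0) :
  span_line v0 = horizontal <-> v ord0 1 = 0.
Proof.
rewrite span_line_eqP dot_perp !mxE/= mulr1 mulr0 subr0; split => //.
Qed.

Lemma slope_span v (v0 : v != 0) : slope (span_line v0) = - (v ord0 0 / v ord0 1).
Proof.
rewrite /slope; have [c c0 ->] := unit_vector_span v0; rewrite !mxE.
by rewrite -mulf_div divff// mul1r.
Qed.

Lemma slanted_neq0 (k : R) : - k *: delta_mx ord0 0 + delta_mx ord0 1 != 0 :> plane.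
Proof.
by apply/eqP => /rowP/(_ 1); rewrite !mxE/= mulr0 add0r => /eqP; rewrite oner_eq0.
Qed.

Definition line_of_slope (k : R) : dline R := span_line (slanted_neq0 k).

Lemma slopeK L : L <> horizontal -> line_of_slope (slope L) = L.
Proof.
have [v [v0 ->]] := dline_spanP L => /span_horizontal/eqP v1.
apply/span_line_eqP; rewrite slope_span dot_perp !mxE/= !mulr1 !mulr0 addr0 add0r.
by rewrite mul1r opprK divfK ?subrr.
Qed.

Lemma measurable_line_of_slope : measurable_fun setT line_of_slope.
Proof.
apply: measurable_fun_dline => U oU; apply: open_measurable.
rewrite (_ : _ @^-1` _ = (fun k : R => - k *: delta_mx ord0 0 + delta_mx ord0 1 : plane) @^-1`
    [set v : plane | exists v0 : v != 0, U (span_line v0)]).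
  apply: open_comp; last exact: open_span_preimage.
  move=> k _; apply: continuous_plane => {}k.
    rewrite (_ : (fun k => _) = fun k : R => - k); last first.
      by apply/funext => l; rewrite !mxE/= mulr1 addr0.
    by apply: cvgN; exact: cvg_id.
  rewrite (_ : (fun k => _) = cst (1 : R)); last first.
    by apply/funext => l; rewrite !mxE/= mulr0 add0r.
  exact: cvg_cst.
apply/seteqP; split => k /=; first by move=> Uk; exists (slanted_neq0 k).
by move=> [v0]; rewrite (Prop_irrelevance v0 (slanted_neq0 k)).
Qed.

(** Serves functions given by a formula on the chart of non-horizontal lines and by a default value
    elsewhere; only their upper level sets inside the chart need checking, and those lift to open
    sets of vectors. *)
Lemma measurable_fun_from_chart d (T : measurableType d) (f : T -> R)
    (O : set T) (c : R) : measurable O ->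
  (forall a, measurable (O `&` [set t | a < f t])) ->
  (forall t, ~ O t -> f t = c) -> measurable_fun setT f.
Proof.
move=> mO mf fc; apply: (measurability _ (RGenOInfty.measurableE R)).
move=> _ [_ [a ->] <-]; rewrite setTI.
rewrite (_ : _ @^-1` _ = (O `&` [set t | a < f t]) `|`
    (if a < c then ~` O else set0)).
  by apply: measurableU => //; case: ifP => // _; exact: measurableC.
apply/seteqP; split => x /=; rewrite in_itv/= andbT.
  by move=> afx; have [Ox|Ox] := pselect (O x); [left|right; rewrite -(fc x Ox) afx].
by move=> [[]//|]; case: ifP => // ac Ox; rewrite (fc x Ox).
Qed.

Lemma measurable_slope : measurable_fun setT slope.
Proof.
apply: (@measurable_fun_from_chart _ _ _ (~` [set horizontal]) 0).
- by apply: measurableC; exact: measurable_dline_set1.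
- move=> a; apply: dline_measurable.
  (* Multiplying by the square of the second coordinate clears the denominator without a case
     distinction on signs. The resulting polynomial inequality fails when that coordinate is 0, so
     it also encodes membership in the chart. *)
  rewrite (_ : mkset _ = [set v : plane | a * (v ord0 1 * v ord0 1) < - (v ord0 0 * v ord0 1)]).
    apply: open_ltf.
      by do !apply: continuous_mulf; try exact: coord_continuous; exact: cst_continuous.
    by apply: continuous_oppf; apply: continuous_mulf; exact: coord_continuous.
  have key (v : plane) : v ord0 1 != 0 ->
    (a < - (v ord0 0 / v ord0 1)) = (a * (v ord0 1 * v ord0 1) < - (v ord0 0 * v ord0 1)).
    move=> v1; have v1' : 0 < v ord0 1 * v ord0 1 by rewrite -expr2 exprn_even_gt0.
    rewrite -[LHS](ltr_pM2r v1'); congr (_ < _); field; exact: v1.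
  apply/seteqP; split => v /=.
    by move=> [v0 [/span_horizontal/eqP v1]]; rewrite slope_span key.
  move=> h; have v1 : v ord0 1 != 0.
    by apply: contraTneq h => ->; rewrite !mulr0 oppr0 ltxx.
  have v0 : v != 0 by apply: contraNneq v1 => ->; rewrite mxE.
  by exists v0; split; [apply/span_horizontal/eqP|rewrite slope_span key].
- move=> L /contrapT ->; rewrite slope_span !mxE/= invr0 mulr0 oppr0//.
Qed.

(* The value of [x1 + slope * x2] at all points of a line that is not horizontal;
   slope and offset are both 0 on horizontal lines. *)
Definition offset E : R :=
  if direction E == horizontal then 0 else
  xget 0 (aline_set E) ord0 0 + slope (direction E) * xget 0 (aline_set E) ord0 1.

Lemma offset_through x v (v0 : v != 0) : v ord0 1 != 0 ->
  offset (through x v0) = x ord0 0 - v ord0 0 / v ord0 1 * x ord0 1.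
Proof.
move=> v1; rewrite /offset direction_through slope_span ifF; last first.
  by apply/eqP/span_horizontal/eqP.
have /throughP : aline_set (through x v0) (xget 0 (aline_set (through x v0))).
  apply: (@xgetPex _ 0 (aline_set (through x v0))).
  by exists x; exists 0 => //; rewrite scale0r addr0.
set y := xget _ _; rewrite !dot_perp => h.
apply: (mulIf v1); rewrite !mulrDl !mulNr.
rewrite [v ord0 0 / _ * _ * _]mulrAC [v ord0 0 / _ * _ * _ in RHS]mulrAC !divfK//.
rewrite mulrC [v ord0 0 * _]mulrC.
lra.
Qed.

Lemma measurable_offset : measurable_fun setT offset.
Proof.
have cf1 k : continuous (fun xv : plane * plane => xv.1 ord0 k).
  by apply: continuous_coord => ?; exact: cvg_fst.
have cf2 k : continuous (fun xv : plane * plane => xv.2 ord0 k).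
  by apply: continuous_coord => ?; exact: cvg_snd.
apply: (@measurable_fun_from_chart _ _ _ (~` ((@direction R) @^-1` [set horizontal])) 0).
- apply: measurableC; rewrite -[X in measurable X]setTI.
  exact: measurable_direction (measurable_dline_set1 _).
- move=> a; apply: aline_measurable.
  rewrite (_ : mkset _ = [set xv : plane * plane | a * (xv.2 ord0 1 * xv.2 ord0 1) <
      xv.1 ord0 0 * (xv.2 ord0 1 * xv.2 ord0 1) + - (xv.2 ord0 0 * (xv.2 ord0 1 * xv.1 ord0 1))]).
    apply: open_ltf; last apply: continuous_addf; try apply: continuous_oppf;
      do !apply: continuous_mulf; try exact: cf1; try exact: cf2.
    by exact: cst_continuous.
  have key (x v : plane) : v ord0 1 != 0 ->
    (a < x ord0 0 - v ord0 0 / v ord0 1 * x ord0 1) = (a * (v ord0 1 * v ord0 1) <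
      x ord0 0 * (v ord0 1 * v ord0 1) + - (v ord0 0 * (v ord0 1 * x ord0 1))).
    move=> v1; have v1' : 0 < v ord0 1 * v ord0 1 by rewrite -expr2 exprn_even_gt0.
    rewrite -[LHS](ltr_pM2r v1'); congr (_ < _); field; exact: v1.
  apply/seteqP; split => -[x v] /=.
    move=> [v0 []]; rewrite direction_through => /span_horizontal/eqP v1.
    by rewrite offset_through// key.
  move=> h; have v1 : v ord0 1 != 0.
    by apply: contraTneq h => ->; rewrite !mul0r !mulr0 oppr0 addr0 ltxx.
  have v0 : v != 0 by apply: contraNneq v1 => ->; rewrite mxE.
  have nh : direction (through x v0) <> horizontal.
    by rewrite direction_through; apply/span_horizontal/eqP.
  exists v0; split; first exact: nh.
  by rewrite offset_through ?key.
- by move=> E /contrapT h; rewrite /offset ifT//; apply/eqP.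
Qed.

(** A line misses [K] when its level lies strictly outside the interval between the support values;
    since these are continuous in the normal, the missing lines form an open set. *)
Lemma measurable_hits K : convex_body K -> K !=set0 -> measurable (hits K).
Proof.
move=> cK K0; have [coK _] := cK.
rewrite -[X in measurable X]setCK; apply: measurableC; apply: aline_measurable.
have cf1 k : continuous (fun xv : plane * plane => xv.1 ord0 k).
  by apply: continuous_coord => ?; exact: cvg_fst.
have cf2 k : continuous (fun xv : plane * plane => xv.2 ord0 k).
  by apply: continuous_coord => ?; exact: cvg_snd.
have cP : continuous (fun xv : plane * plane => perp xv.2).
  apply: continuous_plane.
    by under eq_fun do rewrite perp0; apply: continuous_oppf; exact: cf2.
  by under eq_fun do rewrite perp1; exact: cf2.
have cPN : continuous (fun xv : plane * plane => - perp xv.2).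
  by move=> xv; apply: cvgN; exact: cP.
have cd : continuous (fun xv : plane * plane => dot xv.1 (perp xv.2)).
  under eq_fun do rewrite dot_perp.
  by apply: continuous_addf; try apply: continuous_oppf; apply: continuous_mulf.
have cS (F : plane * plane -> plane) : continuous F -> continuous (fun xv => support K (F xv)).
  by move=> cF xv; exact: (continuous_comp (cF xv) (continuous_support coK K0 (x := F xv))).
rewrite (_ : mkset _ = (@snd plane plane) @^-1` [set v : plane | v != 0] `&`
    ([set xv | support K (perp xv.2) < dot xv.1 (perp xv.2)] `|`
     [set xv | dot xv.1 (perp xv.2) < - support K (- perp xv.2)])).
  apply: openI.
    by apply: open_comp; [move=> ? _; exact: cvg_snd|exact: open_neq0].
  apply: openU; apply: open_ltf => //; first exact: cS.
  by apply: continuous_oppf; exact: cS.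
apply/seteqP; split => -[x v] /=.
  move=> [v0 h]; split => //.
  have [/ltW h1|h1] := ltP (support K (perp v)) (dot x (perp v)); last first.
    right; rewrite ltNge; apply/negP => h2; apply: h; apply/hits_throughP => //.
    by rewrite h1 h2.
  have [|h2] := ltP (support K (perp v)) (dot x (perp v)); first by left.
  right; rewrite ltNge; apply/negP => h3; apply: h; apply/hits_throughP => //.
  by rewrite h2 h3.
move=> [v0 h]; exists v0; rewrite hits_throughP// => /andP[h1 h2].
by case: h; rewrite ltNge ?h1 ?h2.
Qed.

End line_measurability.

(** * Motions acting on lines *)

Section motions.
Context {R : realType}.
Local Notation plane := 'rV[R]_2.
Implicit Types (v w x y t : plane) (K : set plane) (L : dline R) (E : aline R).
Implicit Types (Q : 'M[R]_2).

Lemma mulmx_plane x Q (k : 'I_2) :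
  (x *m Q) ord0 k = x ord0 0 * Q 0 k + x ord0 1 * Q 1 k.
Proof.
rewrite mxE big_ord_recl big_ord1; congr (_ * _ + _ * _); congr (_ _ _); exact: val_inj.
Qed.

Lemma rotation_trmx Q : rotation Q -> rotation Q^T.
Proof.
by move=> [QQ dQ]; split; [rewrite trmxK; exact: mulmx1C|rewrite det_tr].
Qed.

Lemma rotationK Q : rotation Q -> forall x, x *m Q *m Q^T = x.
Proof. by move=> [QQ _] x; rewrite -mulmxA QQ mulmx1. Qed.

Lemma rotationKV Q : rotation Q -> forall x, x *m Q^T *m Q = x.
Proof. by move=> [/mulmx1C QQ _] x; rewrite -mulmxA QQ mulmx1. Qed.

Lemma mulmx_rotation_neq0 Q v : rotation Q -> v != 0 -> v *m Q != 0.
Proof.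
move=> rQ; apply: contraNneq => vQ.
by rewrite -(rotationK rQ v) vQ mul0mx.
Qed.

Lemma enorm_rotation Q x : rotation Q -> enorm (x *m Q) = enorm x.
Proof.
move=> [QQ _]; congr (Num.sqrt _).
have dE (y z : plane) : dot y z = (y *m z^T) ord0 ord0.
  by rewrite mxE; apply: eq_bigr => k _; rewrite [in RHS]mxE.
by rewrite !dE trmx_mul mulmxA -(mulmxA x) QQ mulmx1.
Qed.

Lemma rotate_subproof Q (rQ : rotation Q) L : exists2 v, v != 0 &
  [set x *m Q | x in dline_set L] = line 0 v.
Proof.
have [v [v0 ->]] := dline_spanP L; exists (v *m Q).
  exact: mulmx_rotation_neq0.
apply/seteqP; split => [_ [_ [s _ <-] <-]|_ [s _ <-]].
  by exists s => //; rewrite !add0r scalemxAl.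
by exists (s *: v); [exists s => //; rewrite add0r|rewrite add0r scalemxAl].
Qed.

Definition rotate Q (rQ : rotation Q) L : dline R := DLine (rotate_subproof rQ L).

Lemma motion_subproof Q (rQ : rotation Q) t E : exists x, exists2 v, v != 0 &
  [set y *m Q + t | y in aline_set E] = line x v.
Proof.
have [x [v [v0 ->]]] := aline_throughP E; exists (x *m Q + t), (v *m Q).
  exact: mulmx_rotation_neq0.
apply/seteqP; split => [_ [_ [s _ <-] <-]|_ [s _ <-]].
  by exists s => //; rewrite mulmxDl scalemxAl addrAC.
exists (x + s *: v); first by exists s.
by rewrite mulmxDl scalemxAl addrAC.
Qed.

Definition motion Q (rQ : rotation Q) t E : aline R := ALine (motion_subproof rQ t E).

Lemma rotate_span Q (rQ : rotation Q) v (v0 : v != 0) (vQ0 : v *m Q != 0) :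
  rotate rQ (span_line v0) = span_line vQ0.
Proof.
apply/dline_inj/seteqP; split => [_ [_ [s _ <-] <-]|_ [s _ <-]].
  by exists s => //; rewrite !add0r scalemxAl.
by exists (s *: v); [exists s => //; rewrite add0r|rewrite add0r scalemxAl].
Qed.

Lemma motion_through Q (rQ : rotation Q) t x v (v0 : v != 0) (vQ0 : v *m Q != 0) :
  motion rQ t (through x v0) = through (x *m Q + t) vQ0.
Proof.
apply/aline_inj/seteqP; split => [_ [_ [s _ <-] <-]|_ [s _ <-]].
  by exists s => //; rewrite mulmxDl scalemxAl addrAC.
exists (x + s *: v); first by exists s.
by rewrite mulmxDl scalemxAl addrAC.
Qed.

Lemma direction_motion Q (rQ : rotation Q) t E :
  direction (motion rQ t E) = rotate rQ (direction E).
Proof.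
have [x [v [v0 ->]]] := aline_throughP E.
by rewrite (motion_through _ _ _ _ (mulmx_rotation_neq0 rQ v0)) !direction_through
  (rotate_span _ _ (mulmx_rotation_neq0 rQ v0)).
Qed.

Lemma hits_motion Q (rQ : rotation Q) t E :
  hits (@unit_disc R) (motion rQ t E) <->
  hits [set x | enorm (x *m Q + t) <= 1] E.
Proof.
split => [[_ [[x Ex <-]] B]|[x [Ex B]]]; first by exists x.
by exists (x *m Q + t); split => //; exists x.
Qed.

(** The invariance hypothesis speaks of images of sets of lines. The image under the transposed
    rotation is the preimage under [rotate rQ], the form suited to pushforwards. *)
Lemma nu_rotate (nu : set (dline R) -> \bar R) Q (rQ : rotation Q) D :
  rotation_invariant nu -> measurable D -> nu (rotate rQ @^-1` D) = nu D.
Proof.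
move=> nu_inv mD; rewrite -(nu_inv _ (rotation_trmx rQ) _ mD); congr (nu _).
apply/seteqP; split => L /= => [DL|[M DM LM]].
  exists (rotate rQ L) => //=.
  by apply/seteqP; split => [x Lx|_ [_ [x Lx <-] <-]];
    [exists (x *m Q); [exists x|exact: (rotationK rQ x)]|rewrite (rotationK rQ x)].
rewrite (_ : rotate rQ L = M)//; apply: dline_inj; rewrite /= LM.
apply/seteqP; split => [_ [_ [x Lx <-] <-]|x Lx]; first by rewrite (rotationKV rQ x).
by exists (x *m Q^T); [exists x|exact: (rotationKV rQ)].
Qed.

Lemma mu_motion (mu : set (aline R) -> \bar R) Q (rQ : rotation Q) t D :
  motion_invariant mu -> measurable D -> mu (motion rQ t @^-1` D) = mu D.
Proof.
(* The inverse of x |-> x Q + t is x |-> x Q^T - t Q^T. *)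
move=> mu_inv mD; rewrite -(mu_inv _ (- (t *m Q^T)) (rotation_trmx rQ) _ mD); congr (mu _).
have K1 x : (x *m Q + t) *m Q^T - t *m Q^T = x.
  by rewrite mulmxDl addrK (rotationK rQ x).
have K2 x : (x *m Q^T - t *m Q^T) *m Q + t = x.
  by rewrite mulmxBl (rotationKV rQ x) (rotationKV rQ t) subrK.
apply/seteqP; split => E /= => [DE|[F DF EF]].
  exists (motion rQ t E) => //=.
  apply/seteqP; split => [x Ex|_ [_ [x Ex <-] <-]]; last by rewrite K1.
  by exists (x *m Q + t); [exists x|exact: K1].
rewrite (_ : motion rQ t E = F)//; apply: aline_inj; rewrite /= EF.
apply/seteqP; split => [_ [_ [x Fx <-] <-]|x Fx]; first by rewrite K2.
by exists (x *m Q^T - t *m Q^T); [exists x|exact: K2].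
Qed.

Lemma continuous_mulmx_plane Q : continuous (fun x : plane => x *m Q).
Proof.
by apply: continuous_plane; under eq_fun do rewrite mulmx_plane;
  apply: continuous_addf; apply: continuous_mulf; try exact: coord_continuous;
  exact: cst_continuous.
Qed.

Lemma measurable_rotate Q (rQ : rotation Q) : measurable_fun setT (rotate rQ).
Proof.
apply: measurable_fun_dline => U oU; apply: dline_measurable.
rewrite (_ : mkset _ = (fun v : plane => v *m Q) @^-1`
    [set v : plane | exists v0 : v != 0, U (span_line v0)]).
  by apply: open_comp; [move=> ? _; exact: continuous_mulmx_plane|exact: open_span_preimage].
apply/seteqP; split => v /= [v0].
  by rewrite (rotate_span _ _ (mulmx_rotation_neq0 rQ v0)) => h; exists (mulmx_rotation_neq0 rQ v0).
have v0' : v != 0 by apply: contraNneq v0 => ->; rewrite mul0mx.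
by move=> h; exists v0'; rewrite (rotate_span _ _ v0).
Qed.

Lemma rotation1 : rotation (1%:M : 'M[R]_2).
Proof. by split; [rewrite trmx1 mulmx1|exact: det1]. Qed.

Definition translate t E : aline R := motion rotation1 t E.

Lemma translate_through t x v (v0 : v != 0) :
  translate t (through x v0) = through (x + t) v0.
Proof.
apply: aline_inj; have vQ0 := mulmx_rotation_neq0 rotation1 v0.
by rewrite /translate (motion_through _ _ _ _ vQ0) /= !mulmx1.
Qed.

Lemma direction_translate t E : direction (translate t E) = direction E.
Proof.
by have [x [v [v0 ->]]] := aline_throughP E; rewrite translate_through !direction_through.
Qed.

Lemma measurable_translate t : measurable_fun setT (translate t).
Proof.
apply: measurable_fun_aline => U oU; apply: aline_measurable.
rewrite (_ : mkset _ = (fun xv : plane * plane => (xv.1 + t, xv.2)) @^-1`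
    [set xv : plane * plane | exists v0 : xv.2 != 0, U (through xv.1 v0)]).
  apply: open_comp; last exact: open_through_preimage.
  have cF : continuous (fun xv : plane * plane => xv.1 + t).
    by apply: continuous_plane; under eq_fun do rewrite mxE; apply: continuous_addf;
      try exact: cst_continuous; apply: continuous_coord => ?; exact: cvg_fst.
  move=> xv _; exact: (cvg_pair (FF := nbhs_filter xv)
    (FG := nbhs_filter (xv.1 + t)) (FH := nbhs_filter xv.2) (cF xv) cvg_snd).
by apply/seteqP; split => -[x v] /= [v0]; rewrite ?translate_through => h;
  exists v0; rewrite ?translate_through.
Qed.

Lemma offset_translate (s : R) E : direction E <> horizontal ->
  offset (translate (s *: delta_mx ord0 0) E) = offset E + s.
Proof.
have [x [v [v0 ->]]] := aline_throughP E.
rewrite direction_through translate_through => /span_horizontal/eqP v1.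
by rewrite !offset_through// !mxE/= mulr1 mulr0 addr0 addrAC.
Qed.

(** The rotation by the angle arctan k for row vectors: it sends (1, 0) to the direction of (1,
    k). *)
Definition rotmx (k : R) : 'M[R]_2 := (Num.sqrt (1 + k ^+ 2))^-1 *:
  \matrix_(i < 2, j < 2) (if i == j then 1 else if i == 0 then k else - k).

Lemma slope_norm_gt0 (k : R) : 0 < 1 + k ^+ 2.
Proof. by rewrite ltr_pwDl ?sqr_ge0. Qed.

Lemma rotmxP k : rotation (rotmx k).
Proof.
rewrite /rotmx; set c := _^-1.
have ck : c * c * (1 + k * k) = 1.
  rewrite -!expr2 /c exprVn sqr_sqrtr ?ltW ?slope_norm_gt0// mulVf//.
  exact: lt0r_neq0 (slope_norm_gt0 k).
split.
  apply/matrixP => i j; rewrite mxE big_ord_recl big_ord1 !mxE/=.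
  have -> : (lift ord0 ord0 : 'I_2) = 1 by exact: val_inj.
  by case: (ord2P i) => ->; case: (ord2P j) => -> /=; rewrite ?mulr1n ?mulr0n;
    first [ring | rewrite -[RHS]ck; ring].
rewrite detZ (expand_det_row _ 0) big_ord_recl big_ord1 /cofactor !det_mx11 !mxE/= -[RHS]ck.
ring.
Qed.

(** The addition formula for tangents. The excluded case k l = 1 is the one in which the rotated
    line is horizontal. *)
Lemma rotate_line_of_slope (k l : R) : 1 - k * l != 0 ->
  rotate (rotmxP k) (line_of_slope l) = line_of_slope ((k + l) / (1 - k * l)).
Proof.
move=> kl0; rewrite (rotate_span _ _ (mulmx_rotation_neq0 (rotmxP k) (slanted_neq0 l))).
apply/span_line_eqP; rewrite dot_perp !mulmx_plane !mxE/=.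
field; rewrite kl0 sqrtr_eq0 -ltNge; exact: slope_norm_gt0.
Qed.

End motions.

(** * Densities and variances *)

Section measure_theory_complements.
Context d (T : measurableType d) (R : realType).
Local Open Scope ereal_scope.

Lemma integral_indic_weight (m : {measure set T -> \bar R}) (w : T -> \bar R) A :
  measurable A -> \int[m]_(x in A) w x = \int[m]_x (w x * (\1_A x)%:E).
Proof.
move=> mA; rewrite integral_mkcond; apply: eq_integral => x _.
by rewrite patchE indicE; case: (x \in A); rewrite ?mule1 ?mule0.
Qed.

Import HBNNSimple.

(** On simple functions the identity is additivity over their fibres; monotone convergence along
    [nnsfun_approx] passes to the limit on both sides. *)
Lemma integral_density (m m' : {measure set T -> \bar R}) (w : T -> R) :
  measurable_fun setT w -> (forall x, (0 <= w x)%R) ->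
  (forall A, measurable A -> m' A = \int[m]_(x in A) (w x)%:E) ->
  forall g : T -> \bar R, measurable_fun setT g -> (forall x, 0 <= g x) ->
  \int[m']_x g x = \int[m]_x (g x * (w x)%:E).
Proof.
move=> mw w0 m'E g mg g0; pose g_ := nnsfun_approx measurableT mg.
have mgw n : measurable_fun setT (fun x => (g_ n x)%:E * (w x)%:E).
  by apply: emeasurable_funM; apply/measurable_EFinP.
transitivity (limn (fun n => \int[m']_x (g_ n x)%:E)).
  rewrite -monotone_convergence//.
  - apply: eq_integral => x _; apply/esym/cvg_lim => //.
    by apply: cvg_nnsfun_approx => // *; exact: g0.
  - by move=> n; exact/measurable_EFinP.
  - by move=> n x _; rewrite lee_fin.
  - by move=> x _ a b ab; rewrite lee_fin; exact/lefP/nd_nnsfun_approx.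
transitivity (limn (fun n => \int[m]_x ((g_ n x)%:E * (w x)%:E))); last first.
  rewrite -monotone_convergence//.
  - apply: eq_integral => x _; apply/cvg_lim => //.
    by apply: cvgeZr => //; apply: cvg_nnsfun_approx => // *; exact: g0.
  - by move=> n x _; rewrite -EFinM lee_fin mulr_ge0.
  - by move=> x _ a b ab; rewrite -!EFinM lee_fin ler_wpM2r//; exact/lefP/nd_nnsfun_approx.
congr (limn _); apply/funext => n; rewrite integralT_nnsfun sintegralE.
have mA r : measurable (g_ n @^-1` [set r]) by exact: measurable_funPTI.
transitivity (\sum_(r \in range (g_ n))
    \int[m]_x (r%:E * ((w x)%:E * (\1_(g_ n @^-1` [set r]) x)%:E))).
  apply: eq_fsbigr => r /set_mem [y _ <-].
  rewrite m'E// integral_indic_weight// ge0_integralZl//.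
  - by apply: emeasurable_funM; apply/measurable_EFinP => //; exact: measurable_indic.
  - by move=> x _; rewrite -EFinM lee_fin mulr_ge0.
  - by rewrite lee_fin.
rewrite -ge0_integral_fsum//.
- apply: eq_integral => x _; rewrite [in RHS]fimfunE -fsumEFin//.
  rewrite ge0_mule_fsuml; last first.
    by move=> r; rewrite lee_fin; exact: nnfun_muleindic_ge0.
  apply: eq_fsbigr => r _; by rewrite EFinM -muleA (muleC (w x)%:E).
- move=> r; apply: emeasurable_funM; first exact: measurable_cst.
  by apply: emeasurable_funM; apply/measurable_EFinP => //; exact: measurable_indic.
- move=> r x _; rewrite (muleC (w x)%:E) muleA -!EFinM lee_fin; apply: mulr_ge0 => //.
  by rewrite -lee_fin; exact: nnfun_muleindic_ge0.
Qed.

(** Only the first moment is assumed finite, so (X - m)^2 cannot be expanded by linearity. The cross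
    term is integrable; its positive and negative parts are placed on opposite sides and cancelled
    at the end as finite numbers. *)
Lemma variance_add_sqr (P : probability T R) (X : T -> R) :
  P.-integrable setT (EFin \o X) ->
  variance P X + (fine 'E_P[X] ^+ 2)%:E = \int[P]_x (X x ^+ 2)%:E.
Proof.
move=> iX; set m := fine 'E_P[X].
have mX : measurable_fun setT X by apply/measurable_EFinP; exact: measurable_int iX.
have EX : \int[P]_x (X x)%:E = m%:E.
  rewrite /m expectation.unlock fineK//; exact: integrable_fin_num.
pose Z x := (2 * m * X x)%:E.
have iZ : P.-integrable setT Z.
  rewrite (_ : Z = fun x => (2 * m)%:E * (EFin \o X) x).
    exact: integrableZl.
  by apply/funext => x; rewrite /Z EFinM.
have EZ : \int[P]_x Z x = (2 * m ^+ 2)%:E.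
  under eq_integral do rewrite /Z EFinM.
  by rewrite integralZl// EX -EFinM expr2 mulrA.
have mZ : measurable_fun setT Z by exact: measurable_int iZ.
have Zp : \int[P]_x (Z^\+ x) \is a fin_num by exact: integrable_pos_fin_num.
have Zn : \int[P]_x (Z^\- x) \is a fin_num by exact: integrable_neg_fin_num.
have mA : measurable_fun setT (fun x => ((X x - m) ^+ 2)%:E).
  by apply/measurable_EFinP; apply: measurable_funX; exact: measurable_funB.
have mB : measurable_fun setT (fun x => (X x ^+ 2)%:E).
  by apply/measurable_EFinP; exact: measurable_funX.
have VE : variance P X = \int[P]_x ((X x - m) ^+ 2)%:E.
  rewrite /variance covariance.unlock expectation.unlock.
  by apply: eq_integral => x _; rewrite expr2 /m expectation.unlock.
(* Pointwise (X - m)^2 + Z^+ = X^2 + m^2 + Z^-, where all terms are nonnegative. *)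
have h : variance P X + \int[P]_x (Z^\+ x) =
    \int[P]_x (X x ^+ 2)%:E + (m ^+ 2)%:E + \int[P]_x (Z^\- x).
  rewrite VE -ge0_integralD//; last 2 first.
  - by move=> x _; rewrite lee_fin sqr_ge0.
  - exact: measurable_funepos.
  rewrite -[(m ^+ 2)%:E](_ : \int[P]_x (cst (m ^+ 2)%:E x) = _); last first.
    by rewrite integral_cst// [X in _ * X](@probability_setT _ _ _ P) mule1.
  rewrite -ge0_integralD//; last 2 first.
  - by move=> x _; rewrite lee_fin sqr_ge0.
  - by move=> x _; rewrite lee_fin sqr_ge0.
  rewrite -ge0_integralD//; last 3 first.
  - by move=> x _; rewrite -EFinD lee_fin addr_ge0 ?sqr_ge0.
  - exact: emeasurable_funD.
  - exact: measurable_funeneg.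
  apply: eq_integral => x _; rewrite funeposE funenegE /Z /= -?EFinN -!EFin_max -!EFinD.
  congr EFin; move: (X x) => y.
  have [h|h] := (lerP (2 * m * y) 0)%R.
    by rewrite (_ : Order.max (- _) 0 = - (2 * m * y))%R; [ring|apply/max_idPl; rewrite oppr_ge0].
  by rewrite (_ : Order.max (- _) 0 = 0)%R; [ring|apply/max_idPr; rewrite oppr_le0 ltW].
have EZ' : \int[P]_x (Z^\+ x) = \int[P]_x (Z^\- x) + (2 * m ^+ 2)%:E.
  by rewrite -EZ [X in _ = _ + X]integralE addeC subeK.
move: h; rewrite EZ' -(fineK Zn); move: (fine _) => z.
have VB : 0 <= \int[P]_x (X x ^+ 2)%:E by apply: integral_ge0 => x _; rewrite lee_fin sqr_ge0.
have V0 : 0 <= variance P X by rewrite VE; apply: integral_ge0 => x _; rewrite lee_fin sqr_ge0.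
move: V0 VB; case: (variance P X) => [v| |]//; case: (\int[P]_x _) => [b| |]// _ _.
move=> [] e; congr EFin; lra.
Qed.

End measure_theory_complements.

Lemma measurable_invr (R : realType) : measurable_fun setT (fun x : R => x^-1).
Proof.
rewrite -(setUv [set (0 : R)]); apply/measurable_funU => //; first exact: measurableC.
split; first exact: measurable_fun_set1.
apply: open_continuous_measurable_fun; first exact/closed_openC/closed_eq.
by move=> x /[!inE] /eqP x0; exact: inv_continuous.
Qed.

(** Turns a proof of sigma-finiteness into the structure on which Tonelli's theorem is stated, with
    the same underlying measure. *)
Lemma sigma_finite_pack d (T : measurableType d) (R : realType)
    (m : {measure set T -> \bar R}) : sigma_finite setT m ->
  exists m' : {sigma_finite_measure set T -> \bar R}, m = m' :> {measure set T -> \bar R}.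
Proof.
move=> sm.
pose H2 := isSFinite.Build _ _ _ _ (sfinite_measure_sigma_finite sm).
pose H3 := isSigmaFinite.Build _ _ _ _ sm.
pose m' := HB.pack_for (SigmaFiniteMeasure.type T R) (Measure.sort m) H2 H3.
by exists m'; exact: eq_measure.
Qed.

Lemma finite_sigma_finite d (T : measurableType d) (R : realType)
    (m : {measure set T -> \bar R}) : (m setT < +oo)%E -> sigma_finite setT m.
Proof.
by move=> mT; exists (fun=> setT); [rewrite bigcup_const//; exists O|].
Qed.

(** * Uniqueness of the rotation invariant measure *)

Section rotation_invariant_measures.
Context {R : realType}.
Local Notation plane := 'rV[R]_2.
Implicit Types (L M : dline R) (m : {measure set (dline R) -> \bar R}).

Definition rotate_invariant (m : set (dline R) -> \bar R) : Prop :=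
  forall Q (rQ : rotation Q) D, measurable D -> m (rotate rQ @^-1` D) = m D.

(** The determinant of the two images of a spanning vector is a nonzero multiple of k - l. *)
Lemma rotate_rotmx_inj (k l : R) M :
  rotate (rotmxP k) M = rotate (rotmxP l) M -> k = l.
Proof.
have [v [v0 ->]] := dline_spanP M.
rewrite (rotate_span _ _ (mulmx_rotation_neq0 (rotmxP k) v0)).
rewrite (rotate_span _ _ (mulmx_rotation_neq0 (rotmxP l) v0)).
move=> /span_line_eqP; rewrite dot_perp !mulmx_plane /rotmx.
set a := (Num.sqrt (1 + k ^+ 2))^-1; set b := (Num.sqrt (1 + l ^+ 2))^-1.
have a0 : a != 0 by rewrite invr_neq0// sqrtr_eq0 -ltNge slope_norm_gt0.
have b0 : b != 0 by rewrite invr_neq0// sqrtr_eq0 -ltNge slope_norm_gt0.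
have := lt0r_neq0 (dot_gt0 v0); rewrite dotE !mxE/= => d0 h.
have : a * b * (v ord0 0 * v ord0 0 + v ord0 1 * v ord0 1) * (k - l) = 0.
  by rewrite -h; ring.
move=> /eqP; rewrite !mulf_eq0 (negbTE a0) (negbTE b0) (negbTE d0)/= subr_eq0.
by move/eqP.
Qed.

(** The preimages of the line under the rotations [rotmx n] are pairwise disjoint and have equal
    mass, so a positive mass would make the total infinite. *)
Lemma rotate_invariant_set1 m L : (m setT < +oo)%E -> rotate_invariant m ->
  m [set L] = 0%E.
Proof.
move=> mT minv; pose G (n : nat) := rotate (rotmxP (n%:R : R)) @^-1` [set L].
have mG n : measurable (G n).
  by rewrite -[G n]setTI; exact: measurable_rotate (measurable_dline_set1 L).
have mGE n : m (G n) = m [set L] by exact: minv (measurable_dline_set1 L).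
have tG : trivIset setT G.
  move=> i j _ _ [M [/= Mi Mj]]; apply/eqP; rewrite -(eqr_nat R); apply/eqP.
  by apply: (@rotate_rotmx_inj _ _ M); rewrite Mi Mj.
have cfin : m [set L] \is a fin_num.
  rewrite ge0_fin_numE//; apply: le_lt_trans mT; apply: le_measure; rewrite ?inE//.
  exact: measurable_dline_set1.
have Tfin : m setT \is a fin_num by rewrite ge0_fin_numE.
have c0 : 0 <= fine (m [set L]) by rewrite fine_ge0.
have cT n : n%:R * fine (m [set L]) <= fine (m setT).
  rewrite -lee_fin (fineK Tfin); apply: (@le_trans _ _ (m (\bigcup_n G n))); last first.
    by apply: le_measure; rewrite ?inE//; exact: bigcup_measurable.
  rewrite measure_bigcup//; apply: le_trans (nneseries_lim_ge n _); last first.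
    by move=> *; exact: measure_ge0.
  under eq_bigl do rewrite in_setT.
  under eq_bigr do rewrite mGE -(fineK cfin).
  by rewrite sumEFin sumr_const_nat subn0 mulr_natl.
rewrite -(fineK cfin); congr EFin; apply/eqP; rewrite eq_le c0 andbT leNgt.
apply/negP => {}c0; have := cT (Num.truncn (fine (m setT) / fine (m [set L]))).+1.
by rewrite leNgt -ltr_pdivrMr// truncnS_gt.
Qed.

(* The group law of the circle of directions: the addition formula for tangents. *)
Definition slope_add L M : dline R :=
  line_of_slope ((slope L + slope M) / (1 - slope L * slope M)).

Lemma measurable_slope_add :
  measurable_fun setT (fun LM : dline R * dline R => slope_add LM.1 LM.2).
Proof.
apply: (measurableT_comp measurable_line_of_slope).
have m1 : measurable_fun setT (fun LM : dline R * dline R => slope LM.1).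
  by apply: measurableT_comp; [exact: measurable_slope|exact: measurable_fst].
have m2 : measurable_fun setT (fun LM : dline R * dline R => slope LM.2).
  by apply: measurableT_comp; [exact: measurable_slope|exact: measurable_snd].
apply: measurable_funM; first exact: measurable_funD.
apply: (measurableT_comp (@measurable_invr R)); apply: measurable_funB => //.
exact: measurable_funM.
Qed.

Lemma slope_add_rotate L M : L <> horizontal -> M <> horizontal ->
  1 - slope L * slope M != 0 ->
  slope_add L M = rotate (rotmxP (slope L)) M.
Proof.
by move=> hL hM h; rewrite -[in RHS](slopeK hM) rotate_line_of_slope.
Qed.

(** For fixed [L], adding slopes is a rotation outside a null set, and the claim is invariance under
    that rotation. *)
Lemma integral_slope_add m L D : (m setT < +oo)%E -> rotate_invariant m ->
  L <> horizontal -> measurable D ->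
  (\int[m]_M (\1_D (slope_add L M))%:E = m D)%E.
Proof.
move=> mT minv hL mD; rewrite -(minv _ (rotmxP (slope L)) D mD).
have mrD : measurable (rotate (rotmxP (slope L)) @^-1` D).
  by rewrite -[X in measurable X]setTI; exact: measurable_rotate.
rewrite -[in RHS](setIT (_ @^-1` D)) -(integral_indic m measurableT mrD).
(* These are the lines at which the addition formula may fail: slope undefined, or denominator 0. If
   [slope L] is 0, its inverse is 0 too and the second line is merely one more null point. *)
pose N := [set @horizontal R] `|` [set line_of_slope (slope L)^-1].
apply: ge0_ae_eq_integral => //.
- apply/measurable_EFinP; apply: measurableT_comp; first exact: measurable_indic.
  exact: (measurable_fun_pair2 L measurable_slope_add).
- by apply/measurable_EFinP; exact: measurable_indic.
- exists N; split.
  + by apply: measurableU; exact: measurable_dline_set1.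
  + by apply: null_set_setU; rewrite ?rotate_invariant_set1//; exact: measurable_dline_set1.
  + move=> M /= /not_implyP[_ h]; apply: contrapT => /not_orP[hM kM]; apply: h.
    congr EFin; rewrite !indicE; congr (nat_of_bool _)%:R.
    rewrite slope_add_rotate//.
    apply/eqP => /eqP; rewrite subr_eq0 => /eqP k1; apply: kM.
    rewrite -(slopeK hM); congr line_of_slope.
    have k0 : slope L != 0.
      by apply: contra_eqT k1 => /negPn/eqP->; rewrite mul0r oner_eq0.
    by apply: (mulfI k0); rewrite mulfV.
Qed.

(** The integral of 1_D(L + M) over the product is m1(T) m2(D), by invariance of m2 in the inner
    variable. The group law is commutative, so Tonelli's theorem exchanges the two measures. *)
Lemma rotate_invariant_unique (m1 m2 : {measure set (dline R) -> \bar R}) D :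
  (m1 setT < +oo)%E -> (m2 setT < +oo)%E ->
  rotate_invariant m1 -> rotate_invariant m2 -> measurable D ->
  (m1 setT * m2 D = m2 setT * m1 D)%E.
Proof.
move=> f1 f2 i1 i2 mD.
have [s1 e1] := sigma_finite_pack (finite_sigma_finite f1).
have [s2 e2] := sigma_finite_pack (finite_sigma_finite f2).
pose F (LM : dline R * dline R) := (\1_D (slope_add LM.1 LM.2))%:E : \bar R.
have mF : measurable_fun setT F.
  apply/measurable_EFinP; apply: measurableT_comp; first exact: measurable_indic.
  exact: measurable_slope_add.
have F0 x : (0 <= F x)%E by rewrite lee_fin.
have FC L M : F (L, M) = F (M, L).
  by rewrite /F /slope_add/= addrC (mulrC (slope L)).
have key (s s' : {sigma_finite_measure set (dline R) -> \bar R}) :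
    (s setT < +oo)%E -> (s' setT < +oo)%E -> rotate_invariant s -> rotate_invariant s' ->
    (\int[s]_L \int[s']_M F (L, M) = s setT * s' D)%E.
  move=> fs fs' iv iv'.
  rewrite muleC -(integral_cst s measurableT).
  apply: ge0_ae_eq_integral => //.
  - exact: (measurable_fun_fubini_tonelli_F F).
  - by move=> L _; exact: integral_ge0.
  - exists [set horizontal]; split; first exact: measurable_dline_set1.
      exact: rotate_invariant_set1.
    move=> L /= /not_implyP[_ h]; apply: contrapT => hL; apply: h.
    exact: integral_slope_add.
move: f1 f2 i1 i2; rewrite e1 e2 => f1 f2 i1 i2.
rewrite -key// fubini_tonelli//.
under eq_integral do under eq_integral do rewrite FC.
exact: key.
Qed.

End rotation_invariant_measures.

(** * The Cauchy-Crofton formula *)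

Section slope_coordinates.
Context {R : realType}.
Local Notation plane := 'rV[R]_2.
Implicit Types (v w x y t : plane) (K C : set plane) (L : dline R) (E : aline R).

(** The normal (1, k), whose scalar product with the points of a line of slope k is the [offset] of
    the line. It is not a unit vector: its length sqrt(1 + k^2) is the factor relating offsets to
    widths. *)
Definition slope_normal (k : R) : plane := delta_mx ord0 0 + k *: delta_mx ord0 1.

Lemma perp_slanted (k : R) :
  perp (- k *: delta_mx ord0 0 + delta_mx ord0 1) = - slope_normal k.
Proof. by apply: plane_eqP; rewrite !mxE/= ?mxE/=; ring. Qed.

Lemma enorm_slope_normal (k : R) : 0 < enorm (slope_normal k).
Proof.
rewrite lt_neqAle enorm_ge0 andbT eq_sym enorm_eq0; apply/eqP => /rowP/(_ 0).
by rewrite !mxE/= mulr0 addr0 => /eqP; rewrite oner_eq0.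
Qed.

Lemma continuous_slope_normal : continuous slope_normal.
Proof.
apply: continuous_plane.
  rewrite (_ : (fun k => _) = cst 1); first exact: cst_continuous.
  by apply/funext => k; rewrite !mxE/= mulr0 addr0.
rewrite (_ : (fun k => _) = id); first by move=> ?; exact: cvg_id.
by apply/funext => k; rewrite !mxE/= mulr1 add0r.
Qed.

(** Support functions are positively homogeneous, and reversing the sign of the normal only swaps
    the two summands. *)
Lemma width_span K v (v0 : v != 0) : compact K -> K !=set0 ->
  width K (span_line v0) = (support K (perp v) + support K (- perp v)) / enorm v.
Proof.
move=> cK K0; rewrite /width unit_normalE.
have [c c0 uE] := unit_vector_span v0; rewrite uE perpZ.
have := (unit_vectorP (span_line v0)).1; rewrite uE enormZ => cv.
have v1 : enorm v != 0 by rewrite enorm_eq0.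
have -> : (enorm v)^-1 = `|c| by apply: (mulIf v1); rewrite mulVf.
move: c0; rewrite neq_lt => /orP[c0|c0].
  rewrite ltr0_norm// mulrDl ![_ * - c]mulrC -!supportZ ?oppr_ge0 ?ltW//.
  by rewrite scalerN !scaleNr opprK addrC.
by rewrite gtr0_norm// mulrDl ![_ * c]mulrC -!supportZ ?ltW// scalerN.
Qed.

Lemma width_slope K L : compact K -> K !=set0 -> L <> horizontal ->
  width K L = (support K (slope_normal (slope L)) +
    support K (- slope_normal (slope L))) / enorm (slope_normal (slope L)).
Proof.
move=> cK K0 hL; rewrite -{1}(slopeK hL) width_span// perp_slanted opprK addrC.
by rewrite -enorm_perp perp_slanted enormN.
Qed.

Lemma measurable_support_slope K (s : bool) : compact K -> K !=set0 ->
  measurable_fun setT (fun L => support K ((-1) ^+ s *: slope_normal (slope L))).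
Proof.
move=> cK K0; apply: (@measurableT_comp _ _ _ _ _ _
  (fun k => support K ((-1) ^+ s *: slope_normal k)) _ slope); last exact: measurable_slope.
apply: continuous_measurable_fun => k.
apply: (continuous_comp (f := fun k => (-1) ^+ s *: slope_normal k)).
  by apply: cvgZl_tmp; exact: continuous_slope_normal.
exact: continuous_support.
Qed.

Lemma measurable_enorm_slope :
  measurable_fun setT (fun L => (enorm (slope_normal (slope L)))^-1).
Proof.
apply: (@measurableT_comp _ _ _ _ _ _ (fun k => (enorm (slope_normal k))^-1) _ slope);
  last exact: measurable_slope.
apply: (measurableT_comp (@measurable_invr R)); apply: continuous_measurable_fun => k.
rewrite (_ : (fun k => _) = fun k => Num.sqrt (1 + k * k)).
  have h : continuous (fun k : R => 1 + k * k).
    by apply: continuous_addf; [exact: cst_continuous|apply: continuous_mulf => ?; exact: cvg_id].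
  exact: (continuous_comp (h k) (@sqrt_continuous R (1 + k * k))).
by apply/funext => l; rewrite /enorm dotE !mxE/= ?mulr1 ?mulr0 ?addr0 ?add0r ?mul1r.
Qed.

Lemma measurable_eq_horizontal : measurable_fun setT (fun L => L == horizontal).
Proof.
apply: (measurable_fun_bool true); rewrite setTI.
rewrite (_ : _ @^-1` _ = [set horizontal]); first exact: measurable_dline_set1.
by apply/seteqP; split => L /= /eqP.
Qed.

Lemma measurable_width K : compact K -> K !=set0 -> measurable_fun setT (width K).
Proof.
move=> cK K0; rewrite (_ : width K = fun L => if L == horizontal then
  width K horizontal else (support K ((-1) ^+ false *: slope_normal (slope L)) +
    support K ((-1) ^+ true *: slope_normal (slope L))) * (enorm (slope_normal (slope L)))^-1).
  apply: measurable_fun_ifT => //; first exact: measurable_eq_horizontal.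
  apply: measurable_funM; last exact: measurable_enorm_slope.
  by apply: measurable_funD; exact: measurable_support_slope.
apply/funext => L; case: eqP => [->//|hL].
by rewrite width_slope// expr0 expr1 scale1r scaleN1r.
Qed.

Lemma hits_slope K E : convex_body K -> K !=set0 -> direction E <> horizontal ->
  hits K E <-> - support K (- slope_normal (slope (direction E))) <= offset E
    <= support K (slope_normal (slope (direction E))).
Proof.
move=> cK K0; have [x [v [v0 ->]]] := aline_throughP E.
rewrite direction_through => /span_horizontal/eqP v1.
(* Rescaling the spanning vector to (-k, 1) turns the level of the line into its offset, up to the
   sign in [perp_slanted]. *)
have -> : through x v0 = through x (slanted_neq0 (slope (span_line v0))).
  have [q qv] : exists q, v ord0 0 = q * v ord0 1.
    by exists (v ord0 0 / v ord0 1); rewrite divfK.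
  apply/aline_inj/seteqP; split => y /throughP e; apply/throughP; move: e;
    rewrite slope_span !dot_perp !mxE/= !(mulr1, mulr0, addr0, add0r) opprK;
    rewrite qv mulfK// => e.
    by apply: (mulIf v1); lra.
  by have {}e := congr1 (fun z : R => z * v ord0 1) e; move: e => /=; lra.
rewrite offset_through; last by rewrite !mxE/= mulr0 add0r oner_eq0.
rewrite hits_throughP// perp_slanted opprK dotNr.
have -> : dot x (slope_normal (slope (span_line v0))) = x ord0 0 -
   (- slope (span_line v0) *: delta_mx ord0 0 + delta_mx ord0 1 : plane) ord0 0 /
   (- slope (span_line v0) *: delta_mx ord0 0 + delta_mx ord0 1 : plane) ord0 1 * x ord0 1.
  by rewrite dotE !mxE/= !(mulr1, mulr0, addr0, add0r) divr1; ring.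
set p := _ - _; rewrite lerN2 andbC lerNl; split; exact.
Qed.

End slope_coordinates.

(** * Consequences of motion invariance: law of directions, sigma-finiteness, null directions *)

Section invariant_line_measures.
Context {R : realType}.
Local Notation plane := 'rV[R]_2.
Variable nu : probability (dline R) R.
Hypothesis nu_inv : rotation_invariant nu.
Variable mu : {measure set (aline R) -> \bar R}.
Hypothesis mu_inv : motion_invariant mu.
Hypothesis mu_disc : mu (hits (@unit_disc R)) = 2%:E.
Implicit Types (v w x y t : plane) (K C : set plane) (L : dline R) (E : aline R).
Local Open Scope ereal_scope.

Lemma convex_body_unit_disc : convex_body (@unit_disc R).
Proof. by rewrite -disc1; exact: convex_body_disc. Qed.

Lemma unit_disc_neq0 : @unit_disc R !=set0.
Proof. by rewrite -disc1; exact: disc_nonempty. Qed.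

Lemma measurable_hits_unit_disc : measurable (hits (@unit_disc R)).
Proof. exact: measurable_hits convex_body_unit_disc unit_disc_neq0. Qed.

Definition disc_directions : {measure set (dline R) -> \bar R}.
Proof.
unshelve refine (pushforward (mrestr mu measurable_hits_unit_disc) (@direction R)).
exact: measurable_direction.
Defined.

Lemma disc_directionsE D :
  disc_directions D = mu (@direction R @^-1` D `&` hits (@unit_disc R)).
Proof. by []. Qed.

Lemma rotate_invariant_disc_directions : rotate_invariant disc_directions.
Proof.
move=> Q rQ D mD; rewrite !disc_directionsE.
have mA : measurable (@direction R @^-1` D `&` hits (@unit_disc R)).
  apply: measurableI; last exact: measurable_hits_unit_disc.
  by rewrite -[X in measurable X]setTI; exact: measurable_direction.
rewrite -(mu_motion rQ 0 mu_inv mA); congr (mu _).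
have unitE : [set x : plane | (enorm (x *m Q + 0) <= 1)%R] = @unit_disc R.
  by apply/seteqP; split => x /=; rewrite addr0 enorm_rotation.
apply/seteqP; split => E /=; rewrite direction_motion hits_motion unitE//.
Qed.

Lemma disc_directions_nu D : measurable D -> disc_directions D = 2%:E * nu D.
Proof.
move=> mD.
have T2 : disc_directions setT = 2%:E by rewrite disc_directionsE preimage_setT setTI.
have nuoo : nu setT < +oo by rewrite [X in X < _](@probability_setT _ _ _ nu) ltry.
have T2oo : disc_directions setT < +oo by rewrite T2 ltry.
have nui : rotate_invariant nu by move=> Q rQ A mA; exact: nu_rotate.
rewrite -T2 -(rotate_invariant_unique nuoo T2oo nui rotate_invariant_disc_directions mD).
by rewrite [X in X * _](@probability_setT _ _ _ nu) mul1e.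
Qed.

Lemma nu_set1 L : nu [set L] = 0.
Proof.
apply: rotate_invariant_set1; first by rewrite [X in X < _](@probability_setT _ _ _ nu) ltry.
by move=> Q rQ A mA; exact: nu_rotate.
Qed.

(** The lines hitting the unit disc centred at the integer point [bz.2] of the axis selected by
    [bz.1]. *)
Definition shifted_disc (bz : bool * int) : set (aline R) :=
  translate (- (bz.2%:~R *: delta_mx ord0 (if bz.1 then 1%R else 0%R))) @^-1` hits (@unit_disc R).

Lemma measurable_shifted_disc bz : measurable (shifted_disc bz).
Proof.
rewrite -[X in measurable X]setTI.
exact: measurable_translate measurable_hits_unit_disc.
Qed.

Lemma mu_shifted_disc bz : mu (shifted_disc bz) = 2%:E.
Proof. by rewrite -mu_disc; exact: mu_motion measurable_hits_unit_disc. Qed.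

(** A horizontal line meets the second axis and any other line the first; the meeting point is
    within distance 1 of the integer point given by the floor of its coordinate. *)
Lemma shifted_disc_cover E : exists bz, shifted_disc bz E.
Proof.
suff [b [s Es]] : exists b : bool, exists s : R,
    aline_set E (s *: delta_mx ord0 (if b then 1%R else 0%R)).
  exists (b, Num.floor s), ((s - (Num.floor s)%:~R) *: delta_mx ord0 (if b then 1%R else 0%R)).
  split.
    by exists (s *: delta_mx ord0 (if b then 1%R else 0%R)) => //; rewrite mulmx1 scalerBl.
  rewrite /unit_disc/= enormZ.
  have -> : enorm (delta_mx ord0 (if b then 1%R else 0%R) : plane) = 1%R.
    by rewrite /enorm dotE !mxE; case: b {Es} => /=; rewrite !(mulr1, mulr0, addr0, add0r) sqrtr1.
  rewrite mulr1 ger0_norm ?subr_ge0 ?floor_le_tmp//.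
  by rewrite lerBlDr addrC; have /ltW := @lt_succ_floor R s; rewrite intrD1.
have [x [v [v0 ->]]] := aline_throughP E.
have [v1|v1] := eqVneq (v ord0 1)%R 0%R.
  exists true, (x ord0 1)%R; apply/throughP; rewrite !dot_perp !mxE/= v1; ring.
exists false, (x ord0 0 - x ord0 1 * (v ord0 0 / v ord0 1))%R; apply/throughP.
by rewrite !dot_perp !mxE/=; field.
Qed.

Definition shifted_disc_seq n : set (aline R) :=
  if unpickle n is Some bz then shifted_disc bz else set0.

Lemma measurable_shifted_disc_seq n : measurable (shifted_disc_seq n).
Proof.
by rewrite /shifted_disc_seq; case: unpickle => // bz; exact: measurable_shifted_disc.
Qed.

Lemma shifted_disc_seq_cover : \bigcup_n shifted_disc_seq n = setT.
Proof.
apply/seteqP; split => // E _; have [bz bzE] := shifted_disc_cover E.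
by exists (pickle bz) => //; rewrite /shifted_disc_seq pickleK.
Qed.

Lemma mu_sigma_finite : sigma_finite setT mu.
Proof.
exists shifted_disc_seq; first by rewrite shifted_disc_seq_cover.
move=> n; split; first exact: measurable_shifted_disc_seq.
by rewrite /shifted_disc_seq; case: unpickle => [bz|]; rewrite ?mu_shifted_disc ?measure0 ltry.
Qed.

(** Translation preserves directions, so each piece of the countable cover has the mass of the piece
    over the unit disc, where the law of directions is 2 nu. *)
Lemma mu_direction_null D : measurable D -> nu D = 0 ->
  mu.-negligible (@direction R @^-1` D).
Proof.
move=> mD D0; have mdD : measurable (@direction R @^-1` D).
  by rewrite -[X in measurable X]setTI; exact: measurable_direction.
have -> : @direction R @^-1` D = \bigcup_n (@direction R @^-1` D `&` shifted_disc_seq n).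
  by rewrite -setI_bigcupr shifted_disc_seq_cover setIT.
apply: negligible_bigcup => n; apply/negligibleP.
  by apply: measurableI => //; exact: measurable_shifted_disc_seq.
rewrite /shifted_disc_seq; case: unpickle => [bz|]; last by rewrite setI0 measure0.
have := disc_directions_nu mD; rewrite D0 mule0 disc_directionsE => <-.
rewrite -(mu_motion rotation1
  (- (bz.2%:~R *: delta_mx ord0 (if bz.1 then 1%R else 0%R))) mu_inv); last first.
  by apply: measurableI => //; exact: measurable_hits_unit_disc.
congr (mu _); apply/seteqP; split => E /=;
  by rewrite -[motion _ _ _]/(translate _ _) direction_translate.
Qed.

Lemma ae_slanted : {ae mu, forall E, direction E <> horizontal}.
Proof.
have := mu_direction_null (measurable_dline_set1 horizontal) (nu_set1 horizontal).
by apply: negligibleS => E /= /contrapT.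
Qed.

Lemma integral_translate t (f : aline R -> \bar R) :
  measurable_fun setT f -> (forall E, 0 <= f E) ->
  \int[mu]_E f (translate t E) = \int[mu]_E f E.
Proof.
move=> mf f0.
transitivity (\int[pushforward mu (translate t)]_E f E).
  by rewrite (ge0_integral_pushforward (measurable_translate t) mu measurableT mf).
apply: eq_measure_integral; first exact: measurable_translate.
by move=> mt A mA _; exact: (mu_motion rotation1 t mu_inv mA).
Qed.

End invariant_line_measures.

(** * Exchange of widths by Tonelli's theorem, and Crofton's formula *)

Section crofton.
Context {R : realType}.
Local Notation plane := 'rV[R]_2.
Variable nu : probability (dline R) R.
Hypothesis nu_inv : rotation_invariant nu.
Variable mu : {measure set (aline R) -> \bar R}.
Hypothesis mu_inv : motion_invariant mu.
Hypothesis mu_disc : mu (hits (@unit_disc R)) = 2%:E.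
Implicit Types (v w x y t : plane) (K C : set plane) (L : dline R) (E : aline R).

(* "The translate of E by (-1)^e s along the first axis hits C", written in slope
   coordinates to make it jointly measurable in E and s; see shifted_hitP. *)
Definition shifted_hit C (e : bool) E (s : R) : bool :=
  let k := slope (direction E) in
  - support C (- slope_normal k) <= offset E + (-1) ^+ e * s <= support C (slope_normal k).

Lemma shifted_hitP C e E s : convex_body C -> C !=set0 -> direction E <> horizontal ->
  shifted_hit C e E s <-> hits C (translate (((-1) ^+ e * s) *: delta_mx ord0 0) E).
Proof.
move=> cC C0 hE; rewrite hits_slope ?direction_translate// offset_translate//.
Qed.

Lemma measurable_shifted_hit C e : convex_body C -> C !=set0 ->
  measurable_fun setT (fun Es : aline R * R => shifted_hit C e Es.1 Es.2).
Proof.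
move=> [cC _] C0.
have md : measurable_fun setT (fun Es : aline R * R => direction Es.1).
  exact: measurableT_comp (@measurable_direction R) measurable_fst.
have mo : measurable_fun setT (fun Es : aline R * R => offset Es.1 + (-1) ^+ e * Es.2).
  apply: measurable_funD; first exact: measurableT_comp (@measurable_offset R) measurable_fst.
  by apply: measurable_funM => //; exact: measurable_snd.
have ms (b : bool) : measurable_fun setT (fun Es : aline R * R =>
    support C ((-1) ^+ b *: slope_normal (slope (direction Es.1)))).
  exact: measurableT_comp (measurable_support_slope b cC C0) md.
apply: measurable_and; apply: measurable_fun_ler => //.
  apply: measurableT_comp => //; have := ms true.
  by under eq_fun do rewrite expr1 scaleN1r.
by have := ms false; under eq_fun do rewrite expr0 scale1r.
Qed.

(** The admissible s form an interval, whose length is the same for both signs [e]. Offsets refer to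
    the normal (1, k) and widths to the unit normal, hence the factor. *)
Lemma integral_shifted_hit C e E : convex_body C -> C !=set0 ->
  direction E <> horizontal ->
  (\int[lebesgue_measure]_s ((shifted_hit C e E s)%:R)%:E =
   (width C (direction E) * enorm (slope_normal (slope (direction E))))%:E :> \bar R)%E.
Proof.
move=> cC C0 hE; have [coC _] := cC.
rewrite width_slope// divfK ?gt_eqF ?enorm_slope_normal//.
set n := slope_normal _; set a := support C n; set b := support C (- n).
have ab : - b <= a.
  have [x Cx] := C0.
  by rewrite (le_trans (support_lb n coC Cx))// support_ub.
transitivity (\int[lebesgue_measure]_s (\1_(if e then `[offset E - a, offset E + b]%classic
    else `[- b - offset E, a - offset E]%classic) s)%:E : \bar R)%E.
  apply: eq_integral => s _; rewrite indicE; congr ((nat_of_bool _)%:R)%:E.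
  apply/idP/idP; rewrite /shifted_hit -/n -/a -/b.
    by move=> /andP[h1 h2]; apply/mem_set; case: e h1 h2 => /=;
      rewrite in_itv/= ?expr1 ?expr0 => h1 h2; apply/andP; split; lra.
  by move=> /set_mem; case: e => /=; rewrite in_itv/= ?expr1 ?expr0 => /andP[h1 h2];
    apply/andP; split; lra.
rewrite integral_indic ?setIT//; last by case: e.
case: e; rewrite /= lebesgue_measure_itv/= lte_fin; case: ltP => h;
  by rewrite -?EFinD; congr EFin; lra.
Qed.

Local Open Scope ereal_scope.

Lemma width_exchange K C (H : dline R -> \bar R) :
  convex_body K -> K !=set0 -> convex_body C -> C !=set0 ->
  measurable_fun setT H -> (forall L, 0 <= H L) ->
  \int[mu]_E (H (direction E) * (width C (direction E))%:E * (\1_(hits K) E)%:E) =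
  \int[mu]_E (H (direction E) * (width K (direction E))%:E * (\1_(hits C) E)%:E).
Proof.
move=> cK K0 cC C0 mH H0.
have [m me] := sigma_finite_pack (mu_sigma_finite mu_inv mu_disc).
have ae_m := ae_slanted nu_inv mu_inv mu_disc.
have int_m := integral_translate mu_inv.
rewrite !me in ae_m int_m *.
pose c E := (enorm (slope_normal (slope (direction E))))^-1%R.
(* The factor [c] cancels the length of the normal in [integral_shifted_hit]; depending on the
   direction only, [W] is unchanged by translations. *)
pose W E := H (direction E) * (c E)%:E.
have c0 E : (0 <= c E)%R by rewrite /c invr_ge0 enorm_ge0.
have mW : measurable_fun setT W.
  apply: emeasurable_funM; first exact: measurableT_comp mH (@measurable_direction R).
  apply/measurable_EFinP.
  exact: measurableT_comp (@measurable_enorm_slope R) (@measurable_direction R).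
have W0 E : 0 <= W E by rewrite mule_ge0// lee_fin.
have Wt t E : W (translate t E) = W E by rewrite /W /c direction_translate.
pose G (K1 K2 : set plane) e (Es : aline R * R) : \bar R :=
  W Es.1 * (\1_(hits K1) Es.1)%:E * ((shifted_hit K2 e Es.1 Es.2)%:R)%:E.
have G0 K1 K2 e Es : 0 <= G K1 K2 e Es by rewrite !mule_ge0// lee_fin.
have mI K1 : convex_body K1 -> K1 !=set0 ->
    measurable_fun setT (\1_(hits K1) : aline R -> R).
  by move=> cK1 K10; apply: measurable_indic; exact: measurable_hits.
have mG K1 K2 e : convex_body K1 -> K1 !=set0 -> convex_body K2 -> K2 !=set0 ->
    measurable_fun setT (G K1 K2 e).
  move=> cK1 K10 cK2 K20; apply: emeasurable_funM; first apply: emeasurable_funM.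
  - exact: measurableT_comp mW measurable_fst.
  - by apply/measurable_EFinP; exact: measurableT_comp (mI _ cK1 K10) measurable_fst.
  - apply/measurable_EFinP.
    rewrite (_ : (fun Es => _) = fun Es : aline R * R =>
      if shifted_hit K2 e Es.1 Es.2 then 1%R else 0%R); last first.
      by apply/funext => Es; case: shifted_hit.
    have := measurable_shifted_hit e cK2 K20 => mh; apply: measurable_fun_ifT => //.
have inner K1 K2 e : convex_body K1 -> K1 !=set0 -> convex_body K2 -> K2 !=set0 ->
    \int[m]_E \int[lebesgue_measure]_s G K1 K2 e (E, s) =
    \int[m]_E (H (direction E) * (width K2 (direction E))%:E * (\1_(hits K1) E)%:E).
  move=> cK1 K10 cK2 K20; have [coK2 _] := cK2; apply: ge0_ae_eq_integral => //.
  - exact: (@measurable_fun_fubini_tonelli_F _ _ _ _ R lebesgue_measure (G K1 K2 e)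
      (mG _ _ _ cK1 K10 cK2 K20) (G0 _ _ _)).
  - apply: emeasurable_funM; last first.
      by apply/measurable_EFinP; exact: mI.
    apply: emeasurable_funM; first exact: measurableT_comp mH (@measurable_direction R).
    apply/measurable_EFinP.
    exact: measurableT_comp (measurable_width coK2 K20) (@measurable_direction R).
  - by move=> E _; exact: integral_ge0.
  - by move=> E _; rewrite !mule_ge0 ?lee_fin ?width_ge0.
  apply: filterS ae_m => E hE _; rewrite /G/= ge0_integralZl//; last 2 first.
  - apply/measurable_EFinP.
    rewrite (_ : (fun s => _) = fun s : R => if shifted_hit K2 e E s then 1%R else 0%R); last first.
      by apply/funext => s; case: shifted_hit.
    apply: measurable_fun_ifT => //.
    exact: (measurable_fun_pair2 E (measurable_shifted_hit e cK2 K20)).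
  - by rewrite mule_ge0// lee_fin.
  rewrite integral_shifted_hit// /W -!muleA; congr (_ * _).
  rewrite -!EFinM; congr EFin; rewrite /c.
  have := enorm_slope_normal (slope (direction E)) => n0; field; exact: lt0r_neq0.
(* For fixed s, substituting E - s e_1 for E turns the condition that E hits K and E + s e_1 hits C
   into the condition that E - s e_1 hits K and E hits C. *)
have shift s : \int[m]_E G K C false (E, s) = \int[m]_E G C K true (E, s).
  pose f E := W E * (\1_(hits K) E)%:E * (\1_(hits C) (translate (s *: delta_mx ord0 0)%R E))%:E.
  have mf : measurable_fun setT f.
    apply: emeasurable_funM; first apply: emeasurable_funM => //.
      by apply/measurable_EFinP; exact: mI.
    by apply/measurable_EFinP; exact: measurableT_comp (mI _ cC C0) (measurable_translate _).
  have f0 E : 0 <= f E by rewrite !mule_ge0// lee_fin.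
  transitivity (\int[m]_E f E).
    apply: ge0_ae_eq_integral => //.
      exact: (measurable_fun_pair1 s (mG _ _ _ cK K0 cC C0)).
    apply: filterS ae_m => E hE _; rewrite /G/= /f; congr (_ * _%:E).
    rewrite indicE; congr (nat_of_bool _)%:R; apply/idP/idP.
      by move=> /(shifted_hitP _ _ cC C0 hE); rewrite expr0 mul1r => h; exact/mem_set.
    by move=> /set_mem h; apply/(shifted_hitP _ _ cC C0 hE); rewrite expr0 mul1r.
  rewrite -(int_m (- s *: delta_mx ord0 0)%R _ mf f0).
  apply: ge0_ae_eq_integral => //.
    exact: measurableT_comp mf (measurable_translate _).
    exact: (measurable_fun_pair1 s (mG _ _ _ cC C0 cK K0)).
  apply: filterS ae_m => E hE _; rewrite /G/= /f Wt.
  have -> : translate (s *: delta_mx ord0 0)%R (translate (- s *: delta_mx ord0 0)%R E) = E.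
    have [x [v [v0 ->]]] := aline_throughP E.
    by rewrite !translate_through scaleNr subrK.
  move: (W E) => w; rewrite -!muleA; congr (w * _); rewrite muleC; congr (_ * _%:E).
  rewrite indicE; congr (nat_of_bool _)%:R; apply/idP/idP.
    by move=> /set_mem h; apply/(shifted_hitP _ _ cK K0 hE); rewrite expr1 mulN1r.
  by move=> /(shifted_hitP _ _ cK K0 hE); rewrite expr1 mulN1r => h; exact/mem_set.
transitivity (\int[m]_E \int[lebesgue_measure]_s G K C false (E, s)).
  exact: esym (inner K C false cK K0 cC C0).
transitivity (\int[m]_E \int[lebesgue_measure]_s G C K true (E, s)); last first.
  exact: inner C K true cC C0 cK K0.
have F1 := @fubini_tonelli _ _ _ _ R m lebesgue_measure (G K C false)
  (mG _ _ _ cK K0 cC C0) (G0 _ _ _).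
have F2 := @fubini_tonelli _ _ _ _ R m lebesgue_measure (G C K true)
  (mG _ _ _ cC C0 cK K0) (G0 _ _ _).
apply: (eq_trans F1); apply: (eq_trans _ (esym F2)).
by apply: eq_integral => s _; exact: shift.
Qed.

Lemma cauchy_crofton K (H : dline R -> \bar R) : convex_body K -> K !=set0 ->
  measurable_fun setT H -> (forall L, 0 <= H L) ->
  \int[mu]_E (H (direction E) * (\1_(hits K) E)%:E) = \int[nu]_L (H L * (width K L)%:E).
Proof.
move=> cK K0 mH H0; have [coK _] := cK.
(* One factor 2 is the width of the unit disc; another comes from the law 2 nu of directions after
   the exchange and removes the half again. *)
pose H' L := H L * (2^-1)%:E.
have mH' : measurable_fun setT H' by apply: emeasurable_funM.
have H'0 L : 0 <= H' L by rewrite mule_ge0// lee_fin.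
have := width_exchange cK K0 convex_body_unit_disc unit_disc_neq0 mH' H'0.
rewrite (eq_integral (fun E => H (direction E) * (\1_(hits K) E)%:E)); last first.
  by move=> E _; rewrite -disc1 width_disc// /H' -(muleA (H _)) -EFinM mulr1 mulVf// mule1.
move=> ->.
have mHw : measurable_fun setT (fun L => H' L * (width K L)%:E).
  by apply: emeasurable_funM => //; apply/measurable_EFinP; exact: measurable_width.
have Hw0 L : 0 <= H' L * (width K L)%:E by rewrite mule_ge0// lee_fin width_ge0.
transitivity (\int[mrestr mu (@measurable_hits_unit_disc R)]_E
   (H' (direction E) * (width K (direction E))%:E)).
  apply/esym/(@integral_density _ _ _ mu (mrestr mu (@measurable_hits_unit_disc R))
    (\1_(hits (@unit_disc R)))) => //.
  - exact: measurable_indic (@measurable_hits_unit_disc R).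
  - by move=> A mA; rewrite (integral_indic mu mA (@measurable_hits_unit_disc R)) setIC.
  - exact: (measurableT_comp mHw (@measurable_direction R)).
transitivity (\int[disc_directions mu]_L (H' L * (width K L)%:E)).
  by rewrite (ge0_integral_pushforward (@measurable_direction R) _ measurableT mHw).
rewrite (@integral_density _ _ _ nu (disc_directions mu) (cst 2%R))//.
  apply: eq_integral => L _; rewrite /H' -!muleA; congr (_ * _).
  by rewrite -!EFinM; congr EFin; field.
move=> A mA; apply: (eq_trans (disc_directions_nu nu_inv mu_inv mu_disc mA)).
by rewrite -(integral_cst nu mA).
Qed.

End crofton.

(** * The optimal weight *)

Section optimal_weight_properties.
Context {R : realType}.
Local Notation plane := 'rV[R]_2.
Variable nu : probability (dline R) R.
Hypothesis nu_inv : rotation_invariant nu.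
Implicit Types (x y u v : plane) (K : set plane) (L : dline R).

(** If all points of [K] coincided, every affine combination would be that one point, and the
    direction space of the hull would be trivial. *)
Lemma has_dim_two_points K d : has_dim K d -> (1 <= d)%N ->
  exists x y, [/\ K x, K y & x != y].
Proof.
move=> [a [V [KV <-]]] V1; apply: contrapT => noxy.
have Keq x y : K x -> K y -> x = y.
  by move=> Kx Ky; apply: contrapT => /eqP xy; apply: noxy; exists x, y.
have hull_eq x y : affine_hull K x -> affine_hull K y -> x = y.
  move=> [[|n] [p [c [Kp c1 ->]]]].
    (* The empty combination is excluded because its coefficients sum to 0. *)
    by move: c1; rewrite big_ord0 => /esym/eqP; rewrite oner_eq0.
  move=> [m [q [e [Kq e1 ->]]]].
  rewrite (eq_bigr (fun k => c k *: p ord0)); last by move=> k _; rewrite (Keq (p k) (p ord0)).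
  rewrite [RHS](eq_bigr (fun k => e k *: p ord0)); last by move=> k _; rewrite (Keq (q k) (p ord0)).
  by rewrite -!scaler_suml c1 e1.
have aV v : v \in V -> affine_hull K (a + v) by move=> vV; rewrite KV; exists v.
have := hull_eq _ _ (aV 0 (mem0v V)) (aV _ (memv_pick V)).
move=> /addrI/esym/eqP; rewrite vpick0 => /eqP V0; move: V1; rewrite V0 dimv0//.
Qed.

Lemma ae_neq L0 : {ae nu, forall L, L <> L0}.
Proof.
have /negligibleP := nu_set1 nu_inv L0 => /(_ (measurable_dline_set1 L0)).
by apply: negligibleS => L /= /contrapT.
Qed.

(** The width is at least the absolute value of the component of x - y along the normal, so it
    vanishes for at most one direction. *)
Lemma width_eq0 K x y L (xy : x - y != 0) : compact K -> K x -> K y ->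
  width K L = 0 -> L = span_line xy.
Proof.
move=> cK Kx Ky; rewrite /width unit_normalE => w0.
have := support_ub (perp (unit_vector L)) cK Kx.
have := support_ub (perp (unit_vector L)) cK Ky.
have := support_ub (- perp (unit_vector L)) cK Kx.
have := support_ub (- perp (unit_vector L)) cK Ky.
rewrite !dotNr => h1 h2 h3 h4.
have : dot (x - y) (perp (unit_vector L)) = 0 by rewrite dotDl dotNl; lra.
have [v [v0 ->]] := dline_spanP L.
have [c c0 ->] := unit_vector_span v0; rewrite perpZ dotZr => /eqP.
rewrite mulf_eq0 (negbTE c0)/= => /eqP h.
by apply/esym/span_line_eqP.
Qed.

Lemma ae_width_gt0 K d : convex_body K -> has_dim K d -> (1 <= d)%N ->
  {ae nu, forall L, 0 < width K L}.
Proof.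
move=> cK dK d1; have [x [y [Kx Ky xy]]] := has_dim_two_points dK d1.
have xy0 : x - y != 0 by rewrite subr_eq0.
apply: filterS (ae_neq (span_line xy0)) => L hL.
rewrite lt_neqAle width_ge0//; last by exists x.
rewrite andbT eq_sym; apply/eqP => w0; apply: hL.
by apply: width_eq0 w0 => //; case: cK.
Qed.

Lemma slope_sqr L : L <> horizontal ->
  unit_vector L ord0 0 ^+ 2 = slope L ^+ 2 * unit_vector L ord0 1 ^+ 2.
Proof.
have [v [v0 ->]] := dline_spanP L => /span_horizontal/eqP v1.
rewrite slope_span; have [c c0 ->] := unit_vector_span v0; rewrite !mxE.
by field.
Qed.

Lemma slope_sqr_eq L (a : R) : L <> horizontal -> slope L ^+ 2 = a ^+ 2 ->
  L = line_of_slope a \/ L = line_of_slope (- a).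
Proof.
move=> hL /eqP; rewrite eqf_sqr => /orP[]/eqP sa; [left|right];
  by rewrite -sa slopeK.
Qed.

(** Each entry vanishes on at most two lines: the off-diagonal ones on the axes, the diagonal ones
    where u_1^2 or u_2^2 is 1/3, that is, where the squared slope is 1/2 or 2. *)
Lemma ae_g_neq0 i j : {ae nu, forall L, g_matrix L i j != 0}.
Proof.
have ne a := ae_neq (line_of_slope a).
pose a := Num.sqrt (2 : R); pose b := Num.sqrt (2^-1 : R).
have a2 : a ^+ 2 = 2 by rewrite sqr_sqrtr.
have b2 : b ^+ 2 = 2^-1 by rewrite sqr_sqrtr// invr_ge0.
apply: filterS3 (filterI (ae_neq horizontal) (ne 0)) (filterI (ne a) (ne (- a)))
  (filterI (ne b) (ne (- b))) => L [hL h0] [ha ha'] [hb hb'].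
apply/eqP; rewrite /g_matrix mxE => /eqP; rewrite mulf_eq0 => /orP[/eqP|/eqP]; first by lra.
have u1 := enorm_unit_vector L; have us := slope_sqr hL.
set u := unit_vector L in u1 us *.
have u10 : u ord0 1 != 0.
  apply/eqP => u10; move: u1; rewrite us u10 expr0n mulr0 addr0 => /esym/eqP.
  by rewrite oner_eq0.
have u0_0 : u ord0 0 != 0.
  apply/eqP => u00; move: us; rewrite u00 expr0n => /esym/eqP.
  rewrite mulf_eq0 !sqrf_eq0 (negbTE u10) orbF => /eqP s0; apply: h0.
  by rewrite -s0 slopeK.
have mix (z : R) : z * u ord0 1 ^+ 2 = slope L ^+ 2 * u ord0 1 ^+ 2 -> z = slope L ^+ 2.
  by move/mulIf; apply; rewrite sqrf_eq0.
case: (ord2P i) => ->; case: (ord2P j) => -> /=.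
- rewrite -expr2 => /eqP; rewrite subr_eq0 => /eqP u0.
  have : 2^-1 = slope L ^+ 2 by apply: mix; lra.
  by rewrite -b2 => /esym/(slope_sqr_eq hL)[].
- by rewrite subr0 => /eqP; rewrite mulf_eq0 (negbTE u10) (negbTE u0_0).
- by rewrite subr0 => /eqP; rewrite mulf_eq0 (negbTE u10) (negbTE u0_0).
- rewrite -expr2 => /eqP; rewrite subr_eq0 => /eqP u1'.
  have : 2 = slope L ^+ 2 by apply: mix; lra.
  by rewrite -a2 => /esym/(slope_sqr_eq hL)[].
Qed.

(** [unit_vector] comes from a choice and offers no measurability; by [g_matrixE] it may be replaced
    by the explicit unit vector (-k, 1) / sqrt(1 + k^2). *)
Lemma measurable_g_matrix i j : measurable_fun setT (fun L : dline R => g_matrix L i j).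
Proof.
pose p k : plane := - k *: delta_mx ord0 0 + delta_mx ord0 1.
pose c k : R := (enorm (slope_normal k))^-1.
rewrite (_ : (fun L => _) = fun L => if L == horizontal then g_matrix horizontal i j else
  3 / 8 * (c (slope L) * p (slope L) ord0 i * (c (slope L) * p (slope L) ord0 j) -
    (if i == j then 1 / 3 else 0))); last first.
  apply/funext => L; case: eqP => [->//|hL].
  have n0 : 0 < enorm (p (slope L)).
    by rewrite -enorm_perp perp_slanted enormN enorm_slope_normal.
  rewrite (@g_matrixE _ L (c (slope L) *: p (slope L))) ?mxE//.
    rewrite enormZ /c -enormN -perp_slanted enorm_perp ger0_norm ?invr_ge0 ?ltW//.
    by rewrite mulVf// gt_eqF.
  rewrite -[in LHS](slopeK hL); apply/seteqP; split => x [t _ <-].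
    exists (t / c (slope L)) => //; rewrite scalerA divfK// invr_eq0 gt_eqF//.
    by rewrite enorm_slope_normal.
  by exists (t * c (slope L)) => //; rewrite scalerA.
have mc : measurable_fun setT (fun L : dline R => c (slope L)) by exact: measurable_enorm_slope.
have mp k : measurable_fun setT (fun L => p (slope L) ord0 k).
  case: (ord2P k) => ->.
    rewrite (_ : (fun L => _) = fun L => - slope L).
      exact: measurableT_comp (@measurable_slope R).
    by apply/funext => L; rewrite !mxE/= mulr1 addr0.
  rewrite (_ : (fun L => _) = fun L => 1); first exact: measurable_cst.
  by apply/funext => L; rewrite !mxE/= mulr0 add0r.
apply: measurable_fun_ifT; [exact: measurable_eq_horizontal|exact: measurable_cst|].
apply: measurable_funM; first exact: measurable_cst.
apply: measurable_funB; last exact: measurable_cst.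
by apply: measurable_funM; apply: measurable_funM.
Qed.

(** A crude bound, used only to make the weight and the estimator integrable. *)
Lemma abs_g_le1 i j L : `|g_matrix L i j| <= 1.
Proof.
have := enorm_unit_vector L; set u := unit_vector L => u1.
have u0 := sqr_ge0 (u ord0 0); have u2 := sqr_ge0 (u ord0 1).
have s1 := sqr_ge0 (u ord0 0 - u ord0 1); have s2 := sqr_ge0 (u ord0 0 + u ord0 1).
rewrite /g_matrix mxE -/u ler_norml.
by case: (ord2P i) => ->; case: (ord2P j) => -> /=; apply/andP; split; nra.
Qed.

Lemma width_le K (r : R) L : 0 < r -> compact K -> K !=set0 -> K `<=` disc r ->
  width K L <= 2 * r.
Proof.
move=> r0 cK K0 Kr; rewrite /width.
have h n : enorm n = 1 -> support K n <= r.
  move=> n1; have [x Kx ->] := support_max n cK K0.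
  rewrite (le_trans (dot_le_enorm _ _))// n1 mulr1.
  exact/(discP _ r0)/Kr.
have := h _ (enorm_unit_normal L); have := h (- unit_normal L).
by rewrite enormN enorm_unit_normal => /(_ erefl); lra.
Qed.

End optimal_weight_properties.

(** * Probability measures given by a density *)

Section density_probability.
Context d (T : measurableType d) (R : realType).
Variables (m : {measure set T -> \bar R}) (w : T -> R).
Local Open Scope ereal_scope.

(* The proofs are arguments so that the measure structure can be inferred. *)
Definition density_probability (mw : measurable_fun setT w)
  (w0 : forall x, (0 <= w x)%R) (w1 : \int[m]_x (w x)%:E = 1) (A : set T) : \bar R :=
  \int[m]_(x in A) (w x)%:E.

Variables (mw : measurable_fun setT w) (w0 : forall x, (0 <= w x)%R)
  (w1 : \int[m]_x (w x)%:E = 1).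
Let P := density_probability mw w0 w1.

Let P0 : P set0 = 0.
Proof. exact: integral_set0. Qed.

Let P_ge0 A : 0 <= P A.
Proof. by apply: integral_ge0 => x _; rewrite lee_fin. Qed.

Let P_add : semi_sigma_additive P.
Proof.
move=> F mF tF mUF; rewrite /P /density_probability ge0_integral_bigcup//.
- by apply: is_cvg_ereal_nneg_natsum_cond => n _ _; exact: P_ge0.
- by apply/measurable_EFinP; exact: measurable_funTS.
- by move=> x _; rewrite lee_fin.
Qed.

HB.instance Definition _ := isMeasure.Build _ _ _ P P0 P_ge0 P_add.

HB.instance Definition _ := Measure_isProbability.Build _ _ _ P w1.

End density_probability.

(** * Weighted random lines and the variance of the estimator *)

Section weighted_lines.
Context {R : realType}.
Local Notation plane := 'rV[R]_2.
Variable nu : probability (dline R) R.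
Hypothesis nu_inv : rotation_invariant nu.
Variable mu : {measure set (aline R) -> \bar R}.
Hypothesis mu_inv : motion_invariant mu.
Hypothesis mu_disc : mu (hits (@unit_disc R)) = 2%:E.
Variable r : R.
Hypothesis r_gt0 : 0 < r.
Implicit Types (K : set plane) (L : dline R) (E : aline R) (f : dline R -> R).

Definition line_density f E : R := (2 * r)^-1 * (\1_(hits (disc r)) E * f (direction E)).

Lemma line_density_ge0 f E : (forall L, 0 <= f L) -> 0 <= line_density f E.
Proof. by move=> f0; rewrite !mulr_ge0// invr_ge0 mulr_ge0// ltW. Qed.

Let measurable_hits_density f : measurable_fun setT f ->
  measurable_fun setT (fun E => \1_(hits (disc r)) E * f (direction E)).
Proof.
move=> mf; apply: measurable_funM.
  apply: measurable_indic; apply: measurable_hits; first exact: convex_body_disc.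
  exact: disc_nonempty.
exact: measurableT_comp mf (@measurable_direction R).
Qed.

Lemma measurable_line_density f : measurable_fun setT f ->
  measurable_fun setT (line_density f).
Proof.
move=> mf; apply: measurable_funM; first exact: measurable_cst.
exact: measurable_hits_density.
Qed.

Local Open Scope ereal_scope.

(** The canonical model is the identity on the space of lines under the law with density
    [line_density f]. Its total mass is 1 by Crofton's formula for the disc, whose width 2r cancels
    the normalisation. *)
Lemma exists_weighted_random_line f : is_density nu f ->
  exists (d : measure_display) (T : measurableType d) (P : probability T R)
    (X : {RV P >-> aline R}), weighted_random_line mu r f X.
Proof.
move=> [mf f0 f1].
have md := measurable_line_density mf.
have d0 E : (0 <= line_density f E)%R by exact: line_density_ge0.
have [cD _] := convex_body_disc r_gt0.
have d1 : \int[mu]_E (line_density f E)%:E = 1.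
  transitivity (\int[mu]_E (((2 * r)^-1 * f (direction E))%:E * (\1_(hits (disc r)) E)%:E)).
    by apply: eq_integral => E _; rewrite -EFinM; congr EFin; rewrite /line_density; ring.
  rewrite (cauchy_crofton nu_inv mu_inv mu_disc (H := fun L => ((2 * r)^-1 * f L)%:E))//.
  - rewrite -[RHS]f1; apply: eq_integral => L _; rewrite width_disc// -EFinM; congr EFin.
    by field; exact: lt0r_neq0.
  - exact: convex_body_disc.
  - exact: disc_nonempty.
  - by apply/measurable_EFinP; apply: measurable_funM => //; exact: measurable_cst.
  - by move=> L; rewrite lee_fin mulr_ge0// invr_ge0 mulr_ge0// ltW.
pose P : probability (aline R) R := density_probability md d0 d1.
pose H := isMeasurableFun.Build _ _ _ _ (@id (aline R)) (@measurable_id _ (aline R) setT).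
pose X : {RV P >-> aline R} := HB.pack_for {mfun (aline R) >-> (aline R)} (@id (aline R)) H.
exists _, (aline R), P, X => D mD.
rewrite /distribution /pushforward /= /density_probability -ge0_integralZl//.
- by apply: measurable_funTS; apply/measurable_EFinP; exact: measurable_hits_density.
- by move=> E _; rewrite lee_fin mulr_ge0.
- by rewrite lee_fin invr_ge0 mulr_ge0// ltW.
Qed.

Section law.
Variables (f : dline R -> R) (d : measure_display) (T : measurableType d)
  (P : probability T R) (X : {RV P >-> aline R}).
Hypothesis f_density : is_density nu f.
Hypothesis fX : weighted_random_line mu r f X.

(** Since [K] lies in the disc, the indicator of hitting the disc is 1 on every line that hits [K];
    what remains is Crofton's formula with [f / (2 * r)] absorbed into the integrand. *)
Lemma integral_weighted_hits K (H : dline R -> \bar R) :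
  convex_body K -> K !=set0 -> (K `<=` disc r)%classic ->
  measurable_fun setT H -> (forall L, 0 <= H L) ->
  \int[P]_x (H (direction (X x)) * (\1_(hits K) (X x))%:E) =
  \int[nu]_L (H L * (f L * width K L / (2 * r))%:E).
Proof.
move=> cK K0 Kr mH H0; have [mf f0 f1] := f_density; have [coK _] := cK.
have mI : measurable_fun setT (\1_(hits K) : aline R -> R).
  by apply: measurable_indic; exact: measurable_hits.
have mHd : measurable_fun setT (fun E => H (direction E)).
  exact: measurableT_comp mH (@measurable_direction R).
have mG : measurable_fun setT (fun E => H (direction E) * (\1_(hits K) E)%:E).
  by apply: emeasurable_funM => //; exact/measurable_EFinP.
have G0 E : 0 <= H (direction E) * (\1_(hits K) E)%:E by rewrite mule_ge0// lee_fin.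
rewrite -(ge0_integral_distribution X mG G0).
rewrite (@integral_density _ _ _ mu (distribution P X) (line_density f))//; first last.
- move=> D mD; apply: (eq_trans (fX mD)); rewrite -ge0_integralZl//.
  + by apply: measurable_funTS; apply/measurable_EFinP; exact: measurable_hits_density.
  + by move=> E _; rewrite lee_fin mulr_ge0.
  + by rewrite lee_fin invr_ge0 mulr_ge0// ltW.
- by move=> E; exact: line_density_ge0.
- exact: measurable_line_density.
pose H' L := H L * (f L / (2 * r))%:E.
transitivity (\int[mu]_E (H' (direction E) * (\1_(hits K) E)%:E)).
  apply: eq_integral => E _; rewrite /H' -!muleA -!EFinM; congr (_ * _%:E).
  rewrite /line_density !indicE.
  case: (boolP (E \in hits K)) => [/set_mem [z [Ez Kz]]|_]; last by rewrite /= mulr0 mul0r.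
  rewrite mem_set/=; first by rewrite !mulr1 !mul1r mulrC.
  by exists z; split => //; exact: Kr.
have fr0 L : (0 <= f L / (2 * r))%R by rewrite mulr_ge0// invr_ge0 mulr_ge0// ltW.
rewrite (cauchy_crofton nu_inv mu_inv mu_disc (H := H'))//.
- apply: eq_integral => L _; rewrite /H' -muleA -EFinM; congr (_ * _%:E); ring.
- apply: emeasurable_funM => //; apply/measurable_EFinP; apply: measurable_funM => //.
- by move=> L; rewrite mule_ge0// lee_fin.
Qed.

End law.

End weighted_lines.

(** * Moments of the estimator and minimisation of the variance *)

Section minimal_variance.
Context {R : realType}.
Local Notation plane := 'rV[R]_2.
Variable nu : probability (dline R) R.
Hypothesis nu_inv : rotation_invariant nu.
Variable mu : {measure set (aline R) -> \bar R}.
Hypothesis mu_inv : motion_invariant mu.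
Hypothesis mu_disc : mu (hits (@unit_disc R)) = 2%:E.
Variable r : R.
Hypothesis r_gt0 : 0 < r.
Variable K : set plane.
Hypothesis K_body : convex_body K.
Hypothesis K_sub : K `<=` disc r.
Variable dim : nat.
Hypothesis K_dim : has_dim K dim.
Hypothesis dim_ge1 : (1 <= dim)%N.
Variables i j : 'I_2.
Implicit Types (L : dline R) (E : aline R) (f : dline R -> R).

Let g L : R := g_matrix L i j.
Let w L : R := optimal_weight r i j K L.
Let W : R := fine (\int[nu]_L (w L)%:E).

Let K_neq0 : K !=set0.
Proof. by have [x [y [Kx _ _]]] := has_dim_two_points K_dim dim_ge1; exists x. Qed.

Let K_compact : compact K. Proof. by case: K_body. Qed.

Let mg : measurable_fun setT g. Proof. exact: measurable_g_matrix. Qed.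

Let mwidth : measurable_fun setT (width K). Proof. exact: measurable_width. Qed.

Let width_nneg L : 0 <= width K L. Proof. exact: width_ge0. Qed.

Let wE L : w L = Num.sqrt (2 * r * width K L) * `|g L|.
Proof. by rewrite /w /optimal_weight projection_lengthE. Qed.

Let w_ge0 L : 0 <= w L.
Proof. by rewrite wE mulr_ge0// sqrtr_ge0. Qed.

Let w_sqr L : w L ^+ 2 = 2 * r * width K L * g L ^+ 2.
Proof.
rewrite wE exprMn real_normK ?num_real// sqr_sqrtr//.
by rewrite mulr_ge0// mulr_ge0// ltW.
Qed.

Let mw : measurable_fun setT w.
Proof.
rewrite (_ : w = fun L => Num.sqrt (2 * r * width K L) * `|g L|); last first.
  by apply/funext => L; exact: wE.
apply: measurable_funM; last exact: measurableT_comp (@normr_measurable R setT) mg.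
apply: (@measurableT_comp _ _ _ _ _ _ (@Num.sqrt R)).
  by apply: continuous_measurable_fun => x; exact: sqrt_continuous.
by apply: measurable_funM => //; exact: measurable_cst.
Qed.

Let w_le L : w L <= 2 * r.
Proof.
rewrite wE; have r2 : 0 <= 2 * r by rewrite mulr_ge0// ltW.
have := width_le L r_gt0 K_compact K_neq0 K_sub => wr.
rewrite -[leRHS]mulr1; apply: ler_pM => //; last exact: abs_g_le1.
have h : 2 * r * width K L <= (2 * r) ^+ 2 by rewrite expr2 ler_wpM2l.
by apply: le_trans (ler_wsqrtr h) _; rewrite sqrtr_sqr ger0_norm.
Qed.

Let ae_w_gt0 : {ae nu, forall L, 0 < w L}.
Proof.
apply: filterS2 (ae_width_gt0 nu_inv K_body K_dim dim_ge1) (ae_g_neq0 nu_inv i j).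
move=> L wL gL; rewrite wE mulr_gt0// ?normr_gt0// sqrtr_gt0 mulr_gt0//.
by rewrite mulr_gt0.
Qed.

Local Open Scope ereal_scope.

Let nuT : nu setT = 1. Proof. exact: probability_setT. Qed.

Let integral_nu_cst (c : R) : \int[nu]_L c%:E = c%:E.
Proof. by have := integral_cst nu measurableT c%:E; rewrite [X in _ * X]nuT mule1. Qed.

Let integral_w_fin : \int[nu]_L (w L)%:E \is a fin_num.
Proof.
rewrite ge0_fin_numE; last by apply: integral_ge0 => L _; rewrite lee_fin.
apply: (@le_lt_trans _ _ (\int[nu]_L (2 * r)%:E)); last by rewrite integral_nu_cst ltry.
apply: ge0_le_integral => //.
- by move=> L _; rewrite lee_fin.
- exact/measurable_EFinP.
- by move=> L _; rewrite lee_fin.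
Qed.

Let integral_wE : \int[nu]_L (w L)%:E = W%:E.
Proof. by rewrite fineK. Qed.

Let W_gt0 : (0 < W)%R.
Proof.
rewrite -lte_fin -integral_wE lt_neqAle integral_ge0 ?andbT; last by move=> L _; rewrite lee_fin.
apply/eqP => w0.
have aew : ae_eq nu setT (EFin \o w) (cst 0).
  apply/ae_eq_integral_abs => //; first exact/measurable_EFinP.
  apply: (eq_trans _ (esym w0)); apply: eq_integral => L _ /=.
  by rewrite ger0_norm// w_ge0.
have [N [mN N0 subN]] : {ae nu, forall L, False}.
  by apply: filterS2 aew ae_w_gt0 => L /(_ I) /= [->]; rewrite ltxx.
have : nu setT <= nu N by apply: le_measure; rewrite ?inE// => L _; apply: subN.
by rewrite nuT N0 leNgt lte01.
Qed.

Lemma optimal_density_is_density : is_density nu (optimal_density nu r i j K).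
Proof.
have mo : measurable_fun setT (optimal_density nu r i j K).
  by apply: measurable_funM; [exact: mw|exact: measurable_cst].
split => //.
  by move=> L; apply: divr_ge0; [exact: w_ge0|exact: ltW W_gt0].
transitivity (\int[nu]_L ((w L)%:E * (W^-1)%:E)); first by apply: eq_integral.
rewrite ge0_integralZr//.
- by rewrite integral_wE -EFinM mulfV// gt_eqF.
- exact/measurable_EFinP.
- by move=> L _; rewrite lee_fin.
- by rewrite lee_fin invr_ge0 ltW.
Qed.

(** The optimum is itself an admissible competitor, against which a minimiser can be tested. *)
Lemma optimal_density_positive : positive_density nu (optimal_density nu r i j K).
Proof.
split; first exact: optimal_density_is_density.
by apply: filterS ae_w_gt0 => L wL; rewrite /optimal_density divr_gt0.
Qed.

(** The value of the estimator on a line that hits [K], which depends on its direction alone. *)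
Let score f L : R := 2 * r * g L / f L.

Let estimatorE f E :
  estimator r i j K f E = (score f (direction E) * \1_(hits K) E)%R.
Proof.
rewrite /estimator /phi_hat /V0 indicE.
have -> : `[< K `&` aline_set E !=set0 >] = (E \in hits K).
  by apply/asboolP/idP => [h|/set_mem]; [apply/mem_set|]; rewrite /hits/= setIC.
by rewrite /score; case: (E \in hits K) => /=; rewrite ?mulr1 ?mulr0 ?mul0r.
Qed.

Let measurable_score f : measurable_fun setT f -> measurable_fun setT (score f).
Proof.
move=> mf; apply: measurable_funM; last exact: measurableT_comp (@measurable_invr R) mf.
by apply: measurable_funM => //; exact: measurable_cst.
Qed.

Let measurable_estimator f : measurable_fun setT f ->
  measurable_fun setT (estimator r i j K f).
Proof.
move=> mf; rewrite (_ : estimator r i j K f =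
  fun E => (score f (direction E) * \1_(hits K) E)%R); last first.
  by apply/funext => E; exact: estimatorE.
apply: measurable_funM.
  exact: measurableT_comp (measurable_score mf) (@measurable_direction R).
by apply: measurable_indic; exact: measurable_hits.
Qed.

Section estimator_moments.
Variables (f : dline R -> R) (d : measure_display) (T : measurableType d)
  (P : probability T R) (X : {RV P >-> aline R}).
Hypothesis f_positive : positive_density nu f.
Hypothesis fX : weighted_random_line mu r f X.

Let f_density : is_density nu f. Proof. by case: f_positive. Qed.

(** The estimator is 0 on lines missing [K]; [phi 0 = 0] removes them from the integral. *)
Lemma integral_estimator (phi : R -> R) : measurable_fun setT phi ->
  (forall x, (0 <= phi x)%R) -> phi 0%R = 0%R ->
  \int[P]_x (phi (estimator r i j K f (X x)))%:E =
  \int[nu]_L (phi (score f L) * (f L * width K L / (2 * r)))%:E.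
Proof.
move=> mphi phi_ge0 phi0; have [mf f0 f1] := f_density.
transitivity (\int[P]_x ((phi (score f (direction (X x))))%:E * (\1_(hits K) (X x))%:E)).
  apply: eq_integral => x _; rewrite estimatorE -EFinM indicE.
  by case: (_ \in _); rewrite ?mulr1// !mulr0 phi0.
rewrite (integral_weighted_hits nu_inv mu_inv mu_disc r_gt0 f_density fX
  (H := fun L => (phi (score f L))%:E))//.
- apply/measurable_EFinP; exact: measurableT_comp mphi (measurable_score mf).
- by move=> L; rewrite lee_fin.
Qed.

(** Positive homogeneity lets the factor 2r / f of the score leave [phi] and cancel the density f /
    (2r), wherever f is positive. Absolute value, positive part and negative part are of this
    kind. *)
Lemma integral_estimator_unbiased (phi : R -> R) : measurable_fun setT phi ->
  (forall x, (0 <= phi x)%R) -> (forall c x, (0 <= c -> phi (x * c) = phi x * c)%R) ->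
  \int[P]_x (phi (estimator r i j K f (X x)))%:E = \int[nu]_L (phi (g L) * width K L)%:E.
Proof.
move=> mphi phi_ge0 phiZ; have [mf f0 f1] := f_density.
have mul_nneg (a b : R) : (0 <= a -> 0 <= b -> 0 <= a * b)%R by exact: mulr_ge0.
have r2 : (0 < 2 * r)%R by rewrite mulr_gt0.
have phi0 : phi 0%R = 0%R by have := phiZ 0%R 0%R (lexx _); rewrite !mulr0.
rewrite integral_estimator//.
have mpg : measurable_fun setT (fun L => phi (g L)) by exact: measurableT_comp mphi mg.
apply: ge0_ae_eq_integral => //.
- apply/measurable_EFinP; apply: measurable_funM.
    exact: measurableT_comp mphi (measurable_score mf).
  by apply: measurable_funM; [exact: measurable_funM|exact: measurable_cst].
- by apply/measurable_EFinP; exact: measurable_funM.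
- move=> L _; rewrite lee_fin mulr_ge0// mulr_ge0 ?mulr_ge0// invr_ge0 ltW//.
- by move=> L _; rewrite lee_fin mulr_ge0.
case: f_positive => _; apply: filterS => L fL _; congr EFin.
have -> : score f L = (g L * (2 * r / f L))%R by rewrite /score; ring.
rewrite phiZ; last by rewrite divr_ge0// ltW.
by field; rewrite (gt_eqF fL) (gt_eqF r_gt0).
Qed.

Lemma integral_estimator_sqr :
  \int[P]_x (estimator r i j K f (X x) ^+ 2)%:E = \int[nu]_L (w L ^+ 2 / f L)%:E.
Proof.
rewrite (integral_estimator (phi := fun x => (x ^+ 2)%R)).
- apply: eq_integral => L _; congr EFin; rewrite w_sqr /score.
  (* Where [f] vanishes both sides are 0, because the inverse of 0 is 0. *)
  have [->|fL] := eqVneq (f L) 0%R; first by rewrite invr0 !(mul0r, mulr0).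
  by field; rewrite fL (gt_eqF r_gt0).
- exact: exprn_measurable.
- by move=> x; exact: sqr_ge0.
- by rewrite expr0n.
Qed.

(** Neither [f] nor [X] occurs. Positive and negative parts are separate because the moment formulas
    concern nonnegative integrands. *)
Definition estimator_mean : \bar R :=
  \int[nu]_L (Num.max (g L) 0 * width K L)%:E - \int[nu]_L (Num.max (- g L) 0 * width K L)%:E.

Lemma expectation_estimator :
  'E_P[estimator r i j K f \o X] = estimator_mean.
Proof.
rewrite expectation.unlock integralE /estimator_mean; congr (_ - _).
  rewrite -(@integral_estimator_unbiased (fun x => Num.max x 0%R)).
  - by apply: eq_integral => x _; rewrite funeposE /= -EFin_max.
  - by apply: measurable_maxr; [exact: measurable_id|exact: measurable_cst].
  - by move=> x; rewrite le_max lexx orbT.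
  - by move=> c x c0; rewrite maxr_pMl// mul0r.
rewrite -(@integral_estimator_unbiased (fun x => Num.max (- x) 0)%R).
- by apply: eq_integral => x _; rewrite funenegE /= -EFin_max.
- by apply: measurable_maxr; [exact: oppr_measurable|exact: measurable_cst].
- by move=> x; rewrite le_max lexx orbT.
- by move=> c x c0; rewrite -mulNr maxr_pMl// mul0r.
Qed.

Lemma integrable_estimator : P.-integrable setT (EFin \o (estimator r i j K f \o X)).
Proof.
have [mf f0 f1] := f_density; apply/integrableP; split.
  apply/measurable_EFinP; apply: measurableT_comp (measurable_estimator mf) _.
  exact: measurable_funPT.
rewrite (_ : \int[P]_x _ = \int[P]_x (`|estimator r i j K f (X x)|%R)%:E)//.
rewrite (@integral_estimator_unbiased (fun x => `|x|%R)).
- apply: (@le_lt_trans _ _ (\int[nu]_L (2 * r)%:E)); last by rewrite integral_nu_cst ltry.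
  apply: ge0_le_integral => //.
  + by move=> L _; rewrite lee_fin mulr_ge0.
  + apply/measurable_EFinP; apply: measurable_funM => //.
    exact: measurableT_comp (@normr_measurable R setT) mg.
  + move=> L _; rewrite lee_fin -[leRHS]mul1r; apply: ler_pM => //; first exact: abs_g_le1.
    exact: width_le.
- exact: normr_measurable.
- by [].
- by move=> c x c0; rewrite normrM (ger0_norm c0).
Qed.

(* The excess over the Cauchy-Schwarz bound: (w - W f)^2 / f integrates the defect
   in w^2 / f + W^2 f >= 2 w W. *)
Definition variance_excess : \bar R := \int[nu]_L ((w L - W * f L) ^+ 2 / f L)%:E.

Lemma variance_estimator : variance P (estimator r i j K f \o X) +
  (fine estimator_mean ^+ 2)%:E = (W ^+ 2)%:E + variance_excess.
Proof.
have [mf f0 f1] := f_density.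
rewrite -expectation_estimator variance_add_sqr; last exact: integrable_estimator.
rewrite integral_estimator_sqr.
have mif : measurable_fun setT (fun L => (f L)^-1%R).
  exact: measurableT_comp (@measurable_invr R) mf.
have ma : measurable_fun setT (fun L => (w L ^+ 2 / f L)%:E).
  by apply/measurable_EFinP; apply: measurable_funM => //; exact: measurable_funX.
have mb : measurable_fun setT (fun L => ((w L - W * f L) ^+ 2 / f L)%:E).
  apply/measurable_EFinP; apply: measurable_funM => //; apply: measurable_funX.
  by apply: measurable_funB => //; apply: measurable_funM => //; exact: measurable_cst.
have a0 L : 0 <= (w L ^+ 2 / f L)%:E by rewrite lee_fin divr_ge0// sqr_ge0.
have b0 L : 0 <= ((w L - W * f L) ^+ 2 / f L)%:E by rewrite lee_fin divr_ge0// sqr_ge0.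
have Wf : \int[nu]_L ((W ^+ 2)%:E * (f L)%:E) = (W ^+ 2)%:E.
  rewrite ge0_integralZl// ?f1 ?mule1//; first exact/measurable_EFinP.
    by move=> L _; rewrite lee_fin.
  by rewrite lee_fin sqr_ge0.
have Ww : \int[nu]_L ((2 * W)%:E * (w L)%:E) = (2 * W ^+ 2)%:E.
  rewrite ge0_integralZl//; first by rewrite integral_wE -EFinM; congr EFin; ring.
  - exact/measurable_EFinP.
  - by move=> L _; rewrite lee_fin.
  - by rewrite lee_fin mulr_ge0// ltW.
(* Integrated form of w^2 / f + W^2 f = 2 W w + (w - W f)^2 / f, valid where f > 0; having no
   subtracted integrals, it also holds when the second moment is infinite. *)
have : \int[nu]_L (w L ^+ 2 / f L)%:E + (W ^+ 2)%:E =
    (2 * W ^+ 2)%:E + variance_excess.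
  rewrite -{1}Wf -Ww /variance_excess -ge0_integralD//; last 2 first.
  - by move=> L _; rewrite -EFinM lee_fin mulr_ge0// sqr_ge0.
  - by apply: emeasurable_funM => //; exact/measurable_EFinP.
  rewrite -ge0_integralD//; last 2 first.
  - by move=> L _; rewrite -EFinM lee_fin mulr_ge0// mulr_ge0// ltW.
  - by apply: emeasurable_funM => //; exact/measurable_EFinP.
  apply: ge0_ae_eq_integral => //.
  - by apply: emeasurable_funD => //; apply: emeasurable_funM => //; exact/measurable_EFinP.
  - by apply: emeasurable_funD => //; apply: emeasurable_funM => //; exact/measurable_EFinP.
  - by move=> L _; rewrite adde_ge0// -EFinM lee_fin mulr_ge0// sqr_ge0.
  - by move=> L _; rewrite adde_ge0// -EFinM lee_fin mulr_ge0// mulr_ge0// ltW.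
  case: f_positive => _; apply: filterS => L fL _; rewrite -!EFinM -!EFinD; congr EFin.
  by field; rewrite (gt_eqF fL).
have A0 : 0 <= \int[nu]_L (w L ^+ 2 / f L)%:E by exact: integral_ge0.
have B0 : 0 <= variance_excess by exact: integral_ge0.
move: A0 B0; case: (\int[nu]_L _) => [a| |]//; case: variance_excess => [b| |]// _ _.
move=> [] e; congr EFin; lra.
Qed.

End estimator_moments.

Lemma variance_excess_eq0 f : positive_density nu f ->
  variance_excess f = 0 <-> \forall L \ae nu, f L = optimal_density nu r i j K L.
Proof.
move=> [[mf f0 f1] fpos].
have mif : measurable_fun setT (fun L => (f L)^-1%R).
  exact: measurableT_comp (@measurable_invr R) mf.
have mb : measurable_fun setT (fun L => ((w L - W * f L) ^+ 2 / f L)%:E).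
  apply/measurable_EFinP; apply: measurable_funM => //; apply: measurable_funX.
  by apply: measurable_funB => //; apply: measurable_funM => //; exact: measurable_cst.
have b0 L : 0 <= ((w L - W * f L) ^+ 2 / f L)%:E by rewrite lee_fin divr_ge0// sqr_ge0.
have W0 := lt0r_neq0 W_gt0.
have -> : variance_excess f = \int[nu]_L `|((w L - W * f L) ^+ 2 / f L)%:E|.
  by apply: eq_integral => L _; rewrite gee0_abs.
apply: (iff_trans (ae_eq_integral_abs nu measurableT mb)); split => h.
  apply: filterS2 h fpos => L /(_ I) /= [/eqP] + fL.
  rewrite mulf_eq0 invr_eq0 (gt_eqF fL) orbF sqrf_eq0 subr_eq0 => /eqP wL.
  by rewrite /optimal_density -/(w L) -/W wL mulrC mulKf.
apply: filterS h => L fL _ /=; congr EFin.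
have -> : (w L - W * f L = 0)%R by rewrite fL /optimal_density -/(w L) -/W; field.
by rewrite expr0n mul0r.
Qed.

Lemma has_minimal_variance_optimal f : positive_density nu f ->
  has_minimal_variance nu mu r i j K f <->
  \forall L \ae nu, f L = optimal_density nu r i j K L.
Proof.
move=> fP; apply: iff_trans (variance_excess_eq0 fP).
have ex0 h : positive_density nu h -> 0 <= variance_excess h.
  move=> [[_ h0 _] _]; apply: integral_ge0 => L _; rewrite lee_fin divr_ge0// sqr_ge0//.
split => [fmin|f0].
  have [d [T [P [X fX]]]] := exists_weighted_random_line nu_inv mu_inv mu_disc r_gt0 fP.1.
  have oP := optimal_density_positive.
  have [d' [T' [P' [Y oY]]]] := exists_weighted_random_line nu_inv mu_inv mu_disc r_gt0 oP.1.
  have := fmin _ _ _ _ fX _ oP _ _ _ _ oY.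
  (* Adding the finite squared mean, common to both densities, is an order equivalence even for
     infinite variances and reduces the comparison to the two excesses. *)
  rewrite -(@leeD2rE _ (fine estimator_mean ^+ 2)%:E)//.
  rewrite (variance_estimator fP fX) (variance_estimator oP oY) leeD2lE//.
  have -> : variance_excess (optimal_density nu r i j K) = 0.
    by apply/(variance_excess_eq0 oP); exact: nearW.
  by move=> le0; apply/eqP; rewrite eq_le le0 ex0.
move=> d T P X fX h hP d' T' P' Y hY.
rewrite -(@leeD2rE _ (fine estimator_mean ^+ 2)%:E)//.
by rewrite (variance_estimator fP fX) (variance_estimator hP hY) leeD2lE// f0 ex0.
Qed.

End minimal_variance.

Unset Implicit Arguments.

Theorem lemma4p9 (R : realType)
  (nu : probability (dline R) R) (nu_inv : rotation_invariant nu)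
  (mu : {measure set (aline R) -> \bar R}) (mu_inv : motion_invariant mu)
  (mu_disc : mu (hits (@unit_disc R)) = 2%:E)
  (r : R) (r_gt0 : 0 < r)
  (K : set 'rV[R]_2) (K_body : convex_body K) (K_sub : K `<=` disc r)
  (d : nat) (K_dim : has_dim K d) (d_ge1 : (1 <= d)%N)
  (i j : 'I_2) :
  is_density nu (optimal_density nu r i j K) /\
  forall f : dline R -> R, positive_density nu f ->
    (has_minimal_variance nu mu r i j K f <->
     \forall L \ae nu, f L = optimal_density nu r i j K L).
Proof.
split; first exact: (optimal_density_is_density nu_inv r_gt0 K_body K_sub K_dim d_ge1).
move=> f fP.
exact: (has_minimal_variance_optimal nu_inv mu_inv mu_disc r_gt0 K_body K_sub K_dim d_ge1 i j fP).
Qed.
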